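(* Let $[E_k]$ be an end of $\Omega$ and let $x\in I[E_k]$ be accessible through $[E_k]$. Then the following are equivalent: (a) $[E_k]$ is a prime end; (b) $[E_k]$ is a singleton end. If $1\le p\in Q(x)$ and $Q(x)\ne(0,1]$, then the following statement is also equivalent to (a) and (b): (c) $[E_k]$ is a $\mathrm{Mod}_p$-prime end.
   Context: Setting: $(X,d,\mu)$ is a metric measure space with more than one point, $\mu$ is a Borel measure with $0<\mu(B)<\infty$ for all balls $B$, and $1\le p<\infty$ is fixed. $X$ is complete, $\mu$ is doubling (there is $C_\mu>0$ with $\mu(B(x,2r))\le C_\mu\mu(B(x,r))$ for all balls), and $X$ supports a $p$-Poincaré inequality: there are $C_{PI}>0$, $\lambda\ge1$ such that for all balls $B$ and all $u\in N^{1,p}(X)$, $\frac{1}{\mu(B)}\int_B|u-u_B|\,d\mu\le C_{PI}\operatorname{diam}(B)\bigl(\frac{1}{\mu(\lambda B)}\int_{\lambda B}g_u^p\,d\mu\bigr)^{1/p}$, where $u_B=\frac{1}{\mu(B)}\int_B u\,d\mu$. Here a nonnegative Borel function $g$ is an upper gradient of $u:X\to[-\infty,\infty]$ if for every nonconstant rectifiable curve $\gamma:[0,l_\gamma]\to X$ parameterized by arc length, $|u(\gamma(0))-u(\gamma(l_\gamma))|\le\int_\gamma g\,ds$ when both values are finite, and $\int_\gamma g\,ds=\infty$ otherwise; $N^{1,p}(X)$ is the space of measurable $u$ with $\int_X|u|^p\,d\mu+\inf_g\int_X g^p\,d\mu<\infty$ (infimum over upper gradients $g$ of $u$), and $g_u$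 is the minimal $p$-weak upper gradient of $u$ (the a.e.-smallest $L^p$ function satisfying the upper gradient inequality for all curves except a family $\Gamma$ for which some nonnegative Borel $\rho\in L^p(X)$ has $\int_\gamma\rho\,ds=\infty$ for all $\gamma\in\Gamma$). $\Omega\subsetneq X$ is a bounded domain (bounded nonempty connected open set); closures and boundaries of subsets of $\Omega$ are taken in $X$. Ends: A bounded connected set $E\subsetneq\Omega$ is acceptable if $\overline E\cap\partial\Omega\ne\varnothing$. A sequence $\{E_k\}_{k=1}^\infty$ of acceptable sets is a chain if (i) $E_{k+1}\subset E_k$ for all $k$; (ii) $\operatorname{dist}(\Omega\cap\partial E_{k+1},\Omega\cap\partial E_k)>0$ for all $k$; (iii) the impression $\bigcap_{k=1}^\infty\overline{E}_k$ is contained in $\partial\Omega$. A chain $\{E_k\}$ divides a chain $\{F_k\}$ if for each $k$ there is $l$ with $E_l\subset F_k$. Two chains are equivalent if they divide each other; an end $[E_k]$ is an equivalence class of chains, and its impression $I[E_k]$ is the impression of any representative chain. Division is well defined between ends. A prime end is an end that is not divisible by any other end. A singleton end is an end whose impression is a single point. Accessibility: $x\in\partial\Omega$ is accessible through $[E_k]$ if there is a (possibly nonrectifiable) curve $\gamma:[0,1]\to X$ with $\gamma(1)=x$, $\gamma([0,1))\subset\Omega$, such that for every $k$ there is $0<t_k<1$ with $\gamma([t_k,1))\subset E_k$. Modulus: for a family $\Gamma$ of nonconstant rectifiable curves, $\mathrm{Mod}_p(\Gamma)=\inf_\rho\int_X\rho^p\,d\mu$, the infimum over nonnegative Borel $\rho$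 with $\int_\gamma\rho\,ds\ge1$ for all $\gamma\in\Gamma$. $\mathrm{Mod}_p(E,F,U)$ is the $p$-modulus of the family of nonconstant rectifiable curves in $U$ starting in $E$ and ending in $F$. A chain $\{E_k\}$ is a $\mathrm{Mod}_p$-chain if $\lim_{k\to\infty}\mathrm{Mod}_p(E_k,K,\Omega)=0$ for every compact $K\subset\Omega$. An end is a $\mathrm{Mod}_p$-end if some $\mathrm{Mod}_p$-chain represents it. A $\mathrm{Mod}_p$-end is a $\mathrm{Mod}_p$-prime end if the only $\mathrm{Mod}_p$-end dividing it is itself. Pointwise dimension set: $Q(x)$ is the set of all $q>0$ for which there are $C_q,R_q>0$ with $\frac{\mu(B(x,r))}{\mu(B(x,R))}\le C_q(r/R)^q$ for all $0<r\le R\le R_q$ (it is a bounded interval with left end point $0$). *)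

(* Defs.v *)
From HB Require Import structures.
From mathcomp Require Import all_boot all_order all_algebra.
From mathcomp Require Import all_classical all_reals all_analysis.
From mathcomp Require Import measurable_realfun.
Set Implicit Arguments.
Unset Strict Implicit.
Unset Printing Implicit Defensive.
Import Order.TTheory GRing.Theory Num.Theory.
Import numFieldNormedType.Exports.
Local Open Scope classical_set_scope.
Local Open Scope ring_scope.

(* The base point carried by [Complete] is only what the library requires to
   put a measurable structure on the space; it is never used. *)
#[short(type="completeMetricType")]
HB.structure Definition CompleteMetric (K : numDomainType) :=
  {M of Metric K M & Complete M}.

Section MetricNotions.
Context {R : realType} {X : completeMetricType R}.
Implicit Types A B U : set X.

Definition mbounded A : Prop := exists x : X, exists r : R, A `<=` ball x r.

Definition boundary A : set X := closure A `\` interior A.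

(* Equal to +oo if one of the two sets is empty. *)
Definition set_dist A B : \bar R :=
  ereal_inf [set (mdist x y)%:E | x in A & y in B].

Definition diam A : \bar R :=
  ereal_sup [set (mdist x y)%:E | x in A & y in A].

Definition bounded_domain U : Prop :=
  [/\ mbounded U, U !=set0, connected U & open U].

(* As in [variation] of the library, [a :: s] lists the points of a partition
   of [a, b] and the last of them is b. *)
Definition curve_length (a b : R) (c : R -> X) : \bar R :=
  ereal_sup [set (\sum_(0 <= i < size s)
      mdist (c (nth b (a :: s) i)) (c (nth b (a :: s) i.+1)))%:E
    | s in itv_partition a b].

(* Nonconstant rectifiable curves, represented by their arc length
   parameterization on [0, arc_len]; values outside this interval are junk. *)
Record rect_curve := RectCurve {
  arc_len : R ;
  arc_fun :> R -> X ;
  arc_len_gt0 : 0 < arc_len ;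
  arc_fun_continuous : {within `[0, arc_len], continuous arc_fun} ;
  arc_fun_length : forall s t : R, 0 <= s -> s <= t -> t <= arc_len ->
    curve_length s t arc_fun = (t - s)%:E
}.

Definition curve_integral (rho : X -> \bar R) (c : rect_curve) : \bar R :=
  (\int[lebesgue_measure]_(t in `[0%R, arc_len c]) rho (c t))%E.

Definition upper_gradient_along (u g : X -> \bar R) (c : rect_curve) : Prop :=
  let a := u (c 0) in
  let b := u (c (arc_len c)) in
  if (a \is a fin_num) && (b \is a fin_num)
  then is_true (`|a - b| <= curve_integral g c)%E
  else curve_integral g c = +oo%E.

Definition curves_between A B U : set rect_curve :=
  [set c | [/\ forall t, 0 <= t <= arc_len c -> U (c t),
               A (c 0) & B (c (arc_len c))]].

End MetricNotions.

Arguments rect_curve {R} X.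

Notation borel X := (g_sigma_algebraType (@open X)).

Section MeasureNotions.
Context {R : realType} {X : completeMetricType R}.
Variable mu : {measure set (borel X) -> \bar R}.
Variable p : R.
Implicit Types (u g rho : X -> \bar R) (Gamma : set (rect_curve X)).

Definition balls_pos_finite : Prop :=
  forall (x : X) (r : R), 0 < r -> (0 < mu (ball x r) < +oo)%E.

Definition doubling : Prop := exists2 C : R, 0 < C &
  forall (x : X) (r : R), 0 < r ->
    (mu (ball x (2 * r)) <= C%:E * mu (ball x r))%E.

Definition borel_nonneg g : Prop :=
  (forall x, (0 <= g x)%E) /\ measurable_fun setT (g : borel X -> \bar R).

(* Measurability with respect to the completion of mu.  For such functions the
   library integral against mu itself, a supremum over Borel simple functions,
   agrees with the integral against the completion. *)
Definition mu_measurable u : Prop :=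
  measurable_fun setT
    (u : g_sigma_algebraType (completed_algebra_gen mu) -> \bar R).

Definition p_energy u : \bar R := (\int[mu]_x (`|u x| `^ p))%E.

Definition upper_gradient u g : Prop :=
  borel_nonneg g /\ forall c : rect_curve X, upper_gradient_along u g c.

Definition newtonian u : Prop :=
  mu_measurable u /\
  (p_energy u + ereal_inf [set p_energy g | g in upper_gradient u] < +oo)%E.

Definition exceptional Gamma : Prop :=
  exists rho, [/\ borel_nonneg rho, (p_energy rho < +oo)%E &
    forall c, Gamma c -> curve_integral rho c = +oo%E].

Definition weak_upper_gradient u g : Prop :=
  [/\ forall x, (0 <= g x)%E, mu_measurable g &
    exists2 Gamma, exceptional Gamma &
      forall c, ~ Gamma c -> upper_gradient_along u g c].

Definition minimal_weak_upper_gradient u g : Prop :=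
  [/\ weak_upper_gradient u g, (p_energy g < +oo)%E &
    forall g', weak_upper_gradient u g' -> (p_energy g' < +oo)%E ->
      {ae mu, forall x, (g x <= g' x)%E}].

Definition average (B : set X) u : \bar R :=
  ((fine (mu B))^-1%:E * \int[mu]_(x in B) u x)%E.

(* The minimal p-weak upper gradient is only determined up to null sets, so the
   inequality is required for each of its representatives. *)
Definition poincare : Prop :=
  exists C lambda : R, [/\ 0 < C, 1 <= lambda &
    forall (x : X) (r : R) u g, 0 < r ->
      newtonian u -> minimal_weak_upper_gradient u g ->
      let B := ball x r in
      (average B (fun y => `|u y - average B u|) <=
       C%:E * diam B *
         (average (ball x (lambda * r)) (fun y => g y `^ p)) `^ p^-1)%E].

Definition modulus Gamma : \bar R :=
  ereal_inf [set p_energy rho | rho in [set rho | borel_nonneg rho /\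
    forall c, Gamma c -> (1 <= curve_integral rho c)%E]].

Definition pointwise_dimension_set (x : X) : set R :=
  [set q | 0 < q /\ exists C R0 : R, [/\ 0 < C, 0 < R0 &
    forall r s : R, 0 < r -> r <= s -> s <= R0 ->
      fine (mu (ball x r)) / fine (mu (ball x s)) <= C * (r / s) `^ q]].

End MeasureNotions.

Section Ends.
Context {R : realType} {X : completeMetricType R}.
Variable Omega : set X.
Implicit Types (E F : nat -> set X) (e f : set (nat -> set X)).

Definition acceptable (A : set X) : Prop :=
  [/\ mbounded A, connected A, A `<` Omega &
      closure A `&` boundary Omega !=set0].

Definition impression E : set X := \bigcap_k closure (E k).

Definition chain E : Prop :=
  [/\ forall k, acceptable (E k),
      forall k, E k.+1 `<=` E k,
      forall k, (0 < set_dist (Omega `&` boundary (E k.+1))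
                              (Omega `&` boundary (E k)))%E &
      impression E `<=` boundary Omega].

Definition divides E F : Prop := forall k, exists l, E l `<=` F k.

Definition equivalent_chains E F : Prop := divides E F /\ divides F E.

Definition end_of E : set (nat -> set X) :=
  [set F | chain F /\ equivalent_chains E F].

Definition is_end e : Prop := exists2 E, chain E & e = end_of E.

(* This and the next definition do not depend on the representatives. *)
Definition end_divides e f : Prop :=
  exists E F, [/\ e E, f F & divides E F].

Definition end_impression e : set X := \bigcup_(E in e) impression E.

Definition prime_end e : Prop :=
  is_end e /\ forall f, is_end f -> end_divides f e -> f = e.

Definition singleton_end e : Prop :=
  is_end e /\ exists x, end_impression e = [set x].

Definition accessible_through E (x : X) : Prop :=
  boundary Omega x /\
  exists c : R -> X, [/\ {within `[0, 1], continuous c},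
    c 1 = x,
    forall t, 0 <= t < 1 -> Omega (c t) &
    forall k, exists2 tk, 0 < tk < 1 &
      forall t, tk <= t < 1 -> E k (c t)].

Variable mu : {measure set (borel X) -> \bar R}.
Variable p : R.

Definition mod_chain E : Prop := chain E /\
  forall K : set X, compact K -> K `<=` Omega ->
    (fun k => modulus mu p (curves_between (E k) K Omega)) @ \oo --> 0%E.

Definition mod_end e : Prop := is_end e /\ exists2 E, e E & mod_chain E.

Definition mod_prime_end e : Prop :=
  mod_end e /\ forall f, mod_end f -> end_divides f e -> f = e.

End Ends.

(* Main.v *)
(* The key remark is that a connected subset of Omega that meets F_(k+1) but is
   not contained in F_k meets both boundaries, hence cannot have small diameter.
   As closed balls are compact, the sets of a chain with a one-point impression
   shrink to that point, so such a chain divides every chain dividing it: singleton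
   ends are prime.  Conversely, the components of Omega in small balls around x
   that contain the end of the given curve form a chain with impression {x} that
   divides E.  Their boundaries in Omega lie on spheres because X is locally
   connected, and this comes from the Poincare inequality: the cutoff of the
   indicator of a relatively clopen part of a ball has a minimal weak upper
   gradient vanishing on the half ball, so it is constant on a smaller ball;
   quasicomponents of a compact ball being connected, balls lie in components of
   larger balls.  The minimal gradient is obtained by minimizing the energy, since
   minima of weak upper gradients are weak upper gradients.
   Finally, a singleton end at x is a Mod_p-end because p in Q(x) makes the
   modulus of the curves leaving a small ball around x tend to 0, as is seen by
   spreading a density over N dyadic annuli (p > 1), or by using one annulus and
   some q > 1 in Q(x) (p = 1). *)

From HB Require Import structures.
Require Import Defs.
From mathcomp Require Import all_boot all_order all_algebra.
From mathcomp Require Import all_classical all_reals all_analysis.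
From mathcomp Require Import measurable_realfun.
From mathcomp Require Import ring lra.
Set Implicit Arguments.
Unset Strict Implicit.
Unset Printing Implicit Defensive.
Import Order.TTheory GRing.Theory Num.Theory.
Import numFieldNormedType.Exports.
Local Open Scope classical_set_scope.
Local Open Scope ring_scope.

(** * Compactness of closed balls *)

Lemma set_seq_cons (T : eqType) (x : T) (s : seq T) :
  [set` x :: s] = x |` [set` s].
Proof.
apply/seteqP; split=> y /=; rewrite inE => /predU1P H.
  by case: H => [->|]; [left|right].
exact: H.
Qed.

Section MetricBasics.
Context {R : realType} {X : completeMetricType R}.
Implicit Types (x y z : X) (A : set X) (r e : R).

Lemma in_ball x r y : ball x r y = (mdist x y < r) :> Prop.
Proof. by rewrite ballEmdist. Qed.

Lemma mdist_lip x y z : `|mdist x y - mdist x z| <= mdist y z.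
Proof.
have := metric_triangle x y z; have := metric_triangle x z y.
rewrite (metric_sym z y) ler_norml => *; apply/andP; split; lra.
Qed.

Lemma continuous_mdist x : continuous (mdist x : X -> R).
Proof.
move=> y; apply/cvgrPdist_le => e e0; near=> z.
apply: (le_trans (mdist_lip _ _ _)); apply: ltW; rewrite -in_ball.
by near: z; exact: nbhsx_ballx.
Unshelve. all: by end_near. Qed.

Lemma openE_ball A : open A <-> forall x, A x -> exists2 r, 0 < r & ball x r `<=` A.
Proof.
rewrite openE; split=> [oA x /oA /nbhs_ballP[r r0 rA]|H x /H[r r0 rA]].
  by exists r.
by apply/nbhs_ballP; exists r.
Qed.

Lemma ball_open_metric x r : open (ball x r : set X).
Proof.
rewrite (_ : ball x r = mdist x @^-1` [set t : R | t < r]); last first.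
  by rewrite ballEmdist.
by apply: open_comp; [move=> y _; exact: continuous_mdist|exact: open_lt].
Qed.

Lemma cball_closed x r : closed [set y : X | mdist x y <= r].
Proof.
rewrite (_ : [set _ | _] = mdist x @^-1` [set t : R | t <= r])//.
by apply: closed_comp; [move=> y _; exact: continuous_mdist|exact: closed_le].
Qed.

Lemma closure_ballP A x :
  closure A x <-> forall e, 0 < e -> exists2 y, A y & mdist x y < e.
Proof.
split=> [cAx e e0|H B /nbhs_ballP[e e0 eB]].
  have [y [Ay]] := cAx _ (nbhsx_ballx x e e0).
  by rewrite in_ball => xy; exists y.
have [y Ay xy] := H _ e0; exists y; split => //.
by apply: eB; rewrite in_ball.
Qed.

(** An ultrafilter containing [A] must contain one ball of each finite cover, hence is Cauchy;
    completeness gives a limit and closedness puts it in [A]. *)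
Lemma totally_bounded_compact A : closed A ->
  (forall e, 0 < e -> exists s : seq X, A `<=` \bigcup_(y in [set` s]) ball y e) ->
  compact A.
Proof.
move=> cA tA; rewrite compact_ultra => F UF FA.
suff /cauchy_cvg FF : cauchy F.
  exists (lim F); split => //.
  by apply: (@closed_cvg _ _ F _ id A cA) => //; exact: FF.
apply: cauchy_exP => e e0; have [s sA] := tA _ e0.
apply: contrapT => nF.
have : F (\bigcap_(y in [set` s]) ~` ball y e).
  elim: s {sA} => [|y s IH]; first by rewrite set_nil bigcap_set0; exact: filterT.
  rewrite set_seq_cons bigcap_setU1; apply: filterI => //.
  by have [Fy|//] := in_ultra_setVsetC (ball y e) UF; case: nF; exists y.
rewrite -setC_bigcup => /(filterI FA) FAs.
have [y [Ay]] := filter_ex FAs; apply; exact: sA.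
Qed.

End MetricBasics.

(** * Doubling measures: packing bounds and compact balls *)

Section Properness.
Context {R : realType} {X : completeMetricType R}.
Variable mu : {measure set (borel X) -> \bar R}.
Implicit Types (x y z : X) (r e : R).

Lemma open_measurable_borel (A : set X) : open A -> measurable (A : set (borel X)).
Proof. by move=> oA; exact: sub_sigma_algebra. Qed.

Lemma measurable_ball_borel x r : measurable (ball x r : set (borel X)).
Proof. by apply: open_measurable_borel; exact: ball_open_metric. Qed.

Lemma subset_ball_metric x y r r' : mdist y x + r <= r' -> ball x r `<=` ball y r'.
Proof.
move=> h z; rewrite !in_ball => xz; apply: le_lt_trans (metric_triangle y x z) _.
by rewrite (lt_le_trans _ h)// ltrD2l.
Qed.

Hypothesis mu_balls : balls_pos_finite mu.
Hypothesis mu_doubling : doubling mu.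

Lemma doubling_iter : exists2 C : R, 0 < C & forall n x r, 0 < r ->
  (mu (ball x (2 ^+ n * r)) <= (C ^+ n)%:E * mu (ball x r))%E.
Proof.
have [C C0 HC] := mu_doubling; exists C => // n x r r0.
elim: n => [|n IH]; first by rewrite !expr0 mul1r mul1e.
rewrite exprS -mulrA; apply: le_trans (HC _ _ _) _.
  by rewrite mulr_gt0// exprn_gt0.
by rewrite exprS EFinM -muleA lee_pmul2l ?lte_fin.
Qed.

Definition separated_seq e (s : seq X) := pairwise (fun y z => e <= mdist y z) s.

(** By the triangle inequality, balls of radius [e / 2] around [e]-separated points are disjoint. *)
Lemma measure_separated e s : separated_seq e s ->
  mu (\bigcup_(y in [set` s]) ball y (e / 2)) =
  (\sum_(y <- s) mu (ball y (e / 2)))%E.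
Proof.
elim: s => [|y s IH] /=.
  by move=> _; rewrite set_nil bigcup_set0 measure0 big_nil.
move=> /andP[/allP ys /IH {}IH]; rewrite set_seq_cons bigcup_setU1 big_cons.
rewrite measureU//; first by congr (_ + _)%E; exact: IH.
- exact: measurable_ball_borel.
- apply: open_measurable_borel; apply: bigcup_open => z _.
  exact: ball_open_metric.
- rewrite -subset0 => z [/= + [t /= ts]]; rewrite !in_ball => yz tz.
  have := metric_triangle y z t; have /= := ys _ ts.
  rewrite (metric_sym z t); lra.
Qed.

(** Volume count: the disjoint balls of radius [e / 2] lie in [ball x (r + e)], and by doubling each
    carries at least the fraction [C ^- n] of its measure. *)
Lemma separated_size x r e : 0 < r -> 0 < e -> exists N, forall s,
  separated_seq e s -> {in s, forall y, mdist x y <= r} -> (size s <= N)%N.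
Proof.
move=> r0 e0; have [C C0 HC] := doubling_iter.
(* With this [n], the ball of radius [2 ^+ n * (e / 2)] around any point within [r] of [x] contains
   [ball x (r + e)]. *)
have [n hn] : exists n, 2 * r + e <= 2 ^+ n * (e / 2).
  have [n hn] : exists n : nat, (2 * r + e) / (e / 2) <= n%:R.
    exists (Num.truncn ((2 * r + e) / (e / 2))).+1.
    by apply/ltW; exact: truncnS_gt.
  exists n; rewrite -ler_pdivrMr ?divr_gt0//; apply: le_trans hn _.
  by rewrite -natrX ler_nat; apply: ltnW; exact: ltn_expl.
have [N hN] : exists N : nat, C ^+ n <= N%:R.
  by exists (Num.truncn (C ^+ n)).+1; apply/ltW; exact: truncnS_gt.
exists N => s se sx.
have mu0 := mu_balls x (addr_gt0 r0 e0).
have lower y : y \in s ->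
    (((C ^+ n)^-1)%:E * mu (ball x (r + e)) <= mu (ball y (e / 2)))%E.
  move=> /sx xy; rewrite lee_pdivrMl ?exprn_gt0//.
  apply: le_trans (HC n y (e / 2) _); last by rewrite divr_gt0.
  apply: le_measure; rewrite ?inE; try exact: measurable_ball_borel.
  apply: subset_ball_metric; rewrite metric_sym; lra.
have upper : (\sum_(y <- s) mu (ball y (e / 2)) <= mu (ball x (r + e)))%E.
  rewrite -measure_separated//; apply: le_measure; rewrite ?inE.
  - apply: open_measurable_borel; apply: bigcup_open => z _.
    exact: ball_open_metric.
  - exact: measurable_ball_borel.
  - apply: bigcup_sub => y /= /sx xy; apply: subset_ball_metric; lra.
have : ((size s)%:R%:E * (((C ^+ n)^-1)%:E * mu (ball x (r + e))) <=
    mu (ball x (r + e)))%E.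
  apply: le_trans upper; rewrite -(@fineK _ (mu (ball x (r + e)))); last first.
    by rewrite ge0_fin_numE//; case/andP: mu0.
  move: lower => /=.
  rewrite -[in X in X -> _](@fineK _ (mu (ball x (r + e)))); last first.
    by rewrite ge0_fin_numE//; case/andP: mu0.
  rewrite -!EFinM; set c := _ * fine _; clear; elim: s => [_|y s IH H] /=.
    by rewrite big_nil mul0r.
  rewrite big_cons -natr1 mulrDl mul1r addrC EFinD leeD ?H ?mem_head//.
  by apply: IH => z zs; apply: H; rewrite inE zs orbT.
case/andP: mu0 => m0 moo.
have mfin : mu (ball x (r + e)) \is a fin_num by rewrite ge0_fin_numE.
move: m0; rewrite -(fineK mfin) -!EFinM lee_fin lte_fin => m0.
rewrite mulrA -[leRHS]mul1r ler_pM2r// ler_pdivrMr ?exprn_gt0// mul1r => h.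
by rewrite -(ler_nat R); exact: le_trans h hN.
Qed.

(** Without a finite [e]-net, points can be added greedily to get separated sequences of any length,
    against the packing bound. *)
Lemma cball_compact x r : compact [set y : X | mdist x y <= r].
Proof.
apply: totally_bounded_compact; first exact: cball_closed.
move=> e e0.
(* The packing bound asks for a positive radius, while [r] is arbitrary here. *)
have r1 : 0 < Num.max r 1 by rewrite lt_max ltr01 orbT.
have [N HN] := separated_size x r1 e0.
apply: contrapT => nH.
have [s [se sx sN]] : exists s, [/\ separated_seq e s,
    {in s, forall y, mdist x y <= r} & size s = N.+1].
  elim: N.+1 => [|n [s [se sx sn]]]; first by exists [::].
  have [y [xy ys]] : exists y, mdist x y <= r /\ {in s, forall z, e <= mdist y z}.
    apply: contrapT => nE; apply: nH; exists s => y /= xy.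
    apply: contrapT => nb; apply: nE; exists y; split=> // z zs.
    rewrite leNgt; apply/negP => yz; apply: nb; exists z => //.
    by rewrite in_ball metric_sym.
  exists (y :: s); split=> /=; last by rewrite sn.
    by rewrite /separated_seq /= -/(separated_seq e s) se andbT; apply/allP => z /ys.
  by move=> z; rewrite inE => /predU1P[->//|/sx].
suff : (N.+1 <= N)%N by rewrite ltnn.
rewrite -sN; apply: HN => // y /sx h.
by rewrite (le_trans h)// le_max lexx.
Qed.

End Properness.

(** * Chains and ends *)

Section Connectedness.
Context {R : realType} {X : completeMetricType R}.
Implicit Types (x y z : X) (A B U : set X) (r e : R).

(** If [A] missed the boundary of [B], then the traces on [A] of [interior B] and [closure B] would
    coincide, giving a nonempty clopen part of [A], hence all of [A]. *)
Lemma connected_boundary A B : connected A -> A `&` B !=set0 -> ~ (A `<=` B) ->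
  A `&` boundary B !=set0.
Proof.
move=> cA [x [Ax Bx]] nAB; apply: contrapT => nb; apply: nAB.
have AcB y : A y -> closure B y -> interior B y.
  by move=> Ay cBy; apply: contrapT => niB; apply: nb; exists y.
have AiB : A `&` interior B = A.
  apply: cA.
  - by exists x; split => //; apply: AcB => //; exact: subset_closure.
  - by exists (interior B) => //; exact: open_interior.
  - exists (closure B); first exact: closed_closure.
    apply/seteqP; split=> y [Ay By]; split=> //; last exact: AcB.
    by apply: subset_closure; exact: interior_subset.
by move=> y; rewrite -AiB => -[_]; exact: interior_subset.
Qed.

Lemma set_dist_gt0 A B : (0 < set_dist A B)%E ->
  exists2 e, 0 < e & forall x y, A x -> B y -> e <= mdist x y.
Proof.
move=> d0; have lb x y : A x -> B y -> (set_dist A B <= (mdist x y)%:E)%E.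
  by move=> Ax By; apply: ereal_inf_lbound; exists x => //; exists y.
move: d0 lb; case: (set_dist A B) => [d| |] //= d0 lb.
  by exists d => // x y Ax By; rewrite -lee_fin; exact: lb.
(* An infinite distance means that one of the sets is empty, so any constant serves. *)
by exists 1 => // x y Ax By; have := lb _ _ Ax By; rewrite leye_eq.
Qed.

Lemma le_set_dist A B e : (forall x y, A x -> B y -> e <= mdist x y) ->
  (e%:E <= set_dist A B)%E.
Proof.
move=> H; apply: le_ereal_inf_tmp => _ [x Ax [y By <-]].
by rewrite lee_fin; exact: H.
Qed.

Lemma within_continuousP (a : set R) (c : R -> X) : {within a, continuous c} ->
  forall t e, a t -> 0 < e -> exists2 d, 0 < d &
    forall s, a s -> `|t - s| < d -> mdist (c t) (c s) < e.
Proof.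
move=> /subspace_continuousP cc t e at_ e0.
have /(_ _ (nbhsx_ballx (c t) e e0)) := cc _ at_.
move=> /nbhs_ballP[d d0 dc]; exists d => // s as_ ts.
by have : ball (c t) e (c s) := dc s ts as_; rewrite in_ball.
Qed.

(** If a boundary point [y] were in [U], its component, a neighbourhood of [y], would meet that of
    [x]; the two would be equal and [y] would be interior. *)
Lemma boundary_component U x y :
  (forall z, U z -> nbhs z (connected_component U z)) ->
  boundary (connected_component U x) y -> ~ U y.
Proof.
move=> H [cy niy] Uy; apply: niy.
have [z [xz yz]] := cy _ (H _ Uy).
have xy := connected_component_trans xz (connected_component_sym yz).
by rewrite /interior (same_connected_component xy); exact: H.
Qed.

End Connectedness.

Section EndsBasics.
Context {R : realType} {X : completeMetricType R}.
Variable Omega : set X.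
Implicit Types (x y z : X) (A B G : set X) (r e : R) (E F : nat -> set X).

Lemma chain_antitone E k l : chain Omega E -> (k <= l)%N -> E l `<=` E k.
Proof.
move=> [_ sE _ _]; elim: l => [|l IH]; first by rewrite leqn0 => /eqP ->.
rewrite leq_eqVlt => /predU1P[->//|]; rewrite ltnS => kl.
by apply: subset_trans (IH kl); exact: sE.
Qed.

Lemma chain_sub E k : chain Omega E -> E k `<=` Omega.
Proof. by move=> [/(_ k)[_ _ [+ _] _]]. Qed.

Lemma chain_connected E k : chain Omega E -> connected (E k).
Proof. by move=> [/(_ k)[_ + _ _]]. Qed.

Lemma chain_nonempty E k : chain Omega E -> E k !=set0.
Proof.
move=> [/(_ k)[_ _ _ [x [cx _]]] _ _ _].
by have [y [Ey _]] := cx _ (filterT : nbhs x setT); exists y.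
Qed.

(* A connected set that meets F_(k+1) but is not contained in F_k meets both
   boundaries, which are at positive distance. *)
Lemma chain_absorbs F k : chain Omega F -> exists2 e, 0 < e &
  forall G, connected G -> G `<=` Omega -> G `&` F k.+1 !=set0 ->
    (forall y z, G y -> G z -> mdist y z < e) -> G `<=` F k.
Proof.
move=> cF; have [_ sF dF _] := cF; have [e e0 He] := set_dist_gt0 (dF k).
exists e => // G cG GO Gk1 Ge; apply: contrapT => nGF.
have [y [Gy By]] : G `&` boundary (F k.+1) !=set0.
  by apply: connected_boundary => //; apply: contra_not nGF => GF z /GF /sF.
have [z [Gz Bz]] : G `&` boundary (F k) !=set0.
  apply: connected_boundary => //.
  by case: Gk1 => z [Gz Fz]; exists z; split => //; exact: sF.
have := He y z (conj (GO _ Gy) By) (conj (GO _ Gz) Bz).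
by rewrite leNgt Ge.
Qed.

Lemma divides_trans F E E' : divides E F -> divides F E' -> divides E E'.
Proof.
move=> EF FE' k; have [l Fl] := FE' k; have [m Em] := EF l.
by exists m; exact: subset_trans Fl.
Qed.

Lemma divides_refl E : divides E E.
Proof. by move=> k; exists k. Qed.

Lemma divides_impression E F : divides E F -> impression E `<=` impression F.
Proof.
move=> EF x Ix k _; have [l El] := EF k.
by apply: (closureS El); exact: Ix.
Qed.

Lemma end_of_self E : chain Omega E -> end_of Omega E E.
Proof. by move=> cE; split=> //; split; exact: divides_refl. Qed.

Lemma end_of_eq E F : divides E F -> divides F E ->
  end_of Omega E = end_of Omega F.
Proof.
move=> EF FE; apply/seteqP; split=> G [cG [h1 h2]]; split => //; split.
- exact: divides_trans FE h1.
- exact: divides_trans h2 EF.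
- exact: divides_trans EF h1.
- exact: divides_trans h2 FE.
Qed.

Lemma end_impressionE E : chain Omega E ->
  end_impression (end_of Omega E) = impression E.
Proof.
move=> cE; apply/seteqP; split=> [x [F [_ [_ FE]]]|x Ex].
  exact: divides_impression.
by exists E => //; exact: end_of_self.
Qed.

(** Division passes to equivalent chains by transitivity, so it can be tested on the given
    representatives. *)
Lemma end_dividesE E F : chain Omega E -> chain Omega F ->
  end_divides (end_of Omega E) (end_of Omega F) <-> divides E F.
Proof.
move=> cE cF; split=> [[E' [F' [[_ [EE' _]] [_ [_ F'F]] E'F']]]|EF].
  apply: divides_trans F'F; apply: divides_trans E'F'.
  by [].
by exists E, F; split => //; exact: end_of_self.
Qed.

Lemma singleton_endE E : chain Omega E ->
  singleton_end Omega (end_of Omega E) <-> exists x, impression E = [set x].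
Proof.
move=> cE; rewrite /singleton_end end_impressionE//; split=> [[]//|h].
by split => //; exists E.
Qed.

(** * Singleton ends are prime *)

Section ProperSpace.
Hypothesis proper : forall x r, compact [set y : X | mdist x y <= r].

(** Otherwise the sets [E k] minus the ball generate a filter on a compact ball; a cluster point
    lies in the impression and yet differs from [x]. *)
Lemma chain_to_point E x : chain Omega E -> impression E = [set x] ->
  forall e, 0 < e -> exists k, E k `<=` ball x e.
Proof.
move=> cE Ix e e0; apply: contrapT => nE.
pose B k := E k `\` ball x e.
have B0 k : B k !=set0.
  apply: contrapT => nB; apply: nE; exists k => y Ey.
  by apply: contrapT => nb; apply: nB; exists y.
have FB : ProperFilter (filter_from [set: nat] B).
  apply: filter_from_proper; last by move=> k _; exact: B0.
  apply: filter_from_filter; first by exists 0%N.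
  move=> i j _ _; exists (maxn i j) => // y [Ey by_]; split; split => //.
    exact: chain_antitone (leq_maxl _ _) _ Ey.
  exact: chain_antitone (leq_maxr _ _) _ Ey.
have [a [r Ear]] : mbounded (E 0%N) by have [/(_ 0%N)[]] := cE.
have [|p [_ clp]] := proper (x := a) (r := r) FB.
  by exists 0%N => // y [/Ear]; rewrite in_ball => /ltW.
have Fp k : closure (B k) p by move=> U Up; apply: clp => //; exists k.
have : impression E p by move=> k _; apply: closureS (Fp k) => y [].
rewrite Ix => /= px.
have : closure (~` ball x e) p by apply: closureS (Fp 0%N) => y [].
have cb : closed (~` ball x e) by exact/open_closedC/ball_open_metric.
by move=> /cb; rewrite px; apply; exact: ballxx.
Qed.

(** Each [E l] contains some [F m], so it meets [F k.+1]; once it is small enough it is absorbed by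
    [F k]. *)
Lemma singleton_chain_divides E F x : chain Omega E -> chain Omega F ->
  impression E = [set x] -> divides F E -> divides E F.
Proof.
move=> cE cF Ix FE k; have [e e0 He] := chain_absorbs k cF.
have [|l El] := chain_to_point cE Ix (e := e / 2); first by rewrite divr_gt0.
have [m Fm] := FE l; exists l; apply: He.
- exact: chain_connected cE.
- exact: chain_sub.
- have [y Fy] := chain_nonempty (maxn m k.+1) cF; exists y; split.
    by apply: Fm; exact: chain_antitone (leq_maxl _ _) _ Fy.
  exact: chain_antitone (leq_maxr _ _) _ Fy.
- move=> y z /El + /El; rewrite !in_ball => xy xz.
  have := metric_triangle y x z; rewrite (metric_sym y x); lra.
Qed.

Lemma singleton_prime E x : chain Omega E -> impression E = [set x] ->
  prime_end Omega (end_of Omega E).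
Proof.
move=> cE Ix; split; first by exists E.
move=> _ [F cF ->] /(end_dividesE cF cE) FE.
by apply: end_of_eq => //; exact: (singleton_chain_divides cE cF Ix FE).
Qed.

End ProperSpace.
End EndsBasics.

(** * The singleton chain around the end point of an access curve *)

Section AccessChain.
Context {R : realType} {X : completeMetricType R}.
Variables (Omega : set X) (c : R -> X) (x : X).
Hypothesis cc : {within `[0, 1], continuous c}.
Hypothesis c1 : c 1 = x.
Hypothesis cO : forall t, 0 <= t < 1 -> Omega (c t).
Hypothesis xO : boundary Omega x.
Implicit Types (y z : X) (r e : R) (E F : nat -> set X).

Definition tail_in (A : set X) := exists2 s, 0 < s < 1 &
  forall t, s <= t < 1 -> A (c t).

Lemma tail_inI (A B : set X) : tail_in A -> tail_in B ->
  exists2 s, 0 < s < 1 & forall t, s <= t < 1 -> A (c t) /\ B (c t).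
Proof.
move=> [s /andP[s0 s1] sA] [s' /andP[s'0 s'1] sB].
exists (Num.max s s'); first by rewrite lt_max s0 gt_max s1.
by move=> t; rewrite ge_max => /andP[/andP[st s't] t1]; split;
  [apply: sA; rewrite st|apply: sB; rewrite s't].
Qed.

(** [F l] and [E k.+1] share a tail of the curve, so a small [F l] is absorbed by [E k]. *)
Lemma tail_divides E F : chain Omega E ->
  (forall k, connected (F k)) -> (forall k, F k `<=` Omega) ->
  (forall e, 0 < e -> exists k, F k `<=` ball x e) ->
  (forall k, tail_in (F k)) -> (forall k, tail_in (E k)) -> divides F E.
Proof.
move=> cE conF FO F0 tF tE k; have [e e0 He] := chain_absorbs k cE.
have [|l Fl] := F0 (e / 2); first by rewrite divr_gt0.
exists l; apply: He => //.
- have [s /andP[s0 s1] sEF] := tail_inI (tF l) (tE k.+1).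
  by exists (c s); apply: sEF; rewrite lexx.
- move=> y z /Fl + /Fl; rewrite !in_ball => xy xz.
  have := metric_triangle y x z; rewrite (metric_sym y x); lra.
Qed.

Lemma tail_ball e : 0 < e -> tail_in (ball x e).
Proof.
move=> e0; have [|d d0 dc] := within_continuousP cc (t := 1) (e := e) _ e0.
  by rewrite /= in_itv /= ler01 lexx.
exists (Num.max (1 - d / 2) (1 / 2)).
  rewrite lt_max gt_max; apply/andP; split; last by apply/andP; split; lra.
  by apply/orP; right; lra.
move=> t; rewrite ge_max => /andP[/andP[h1 h2] h3].
rewrite in_ball -c1; apply: dc; first by rewrite /= in_itv /=; apply/andP; split; lra.
by rewrite ger0_norm; lra.
Qed.

Hypothesis Omega_open : open Omega.
Hypothesis locally_connected : forall (U : set X) y, open U -> U y ->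
  nbhs y (connected_component U y).

(** [F k] is the component, in the part of [Omega] inside a ball of radius [r k] around [x], that
    contains a tail of the curve. *)
Lemma access_chain : exists F, [/\ chain Omega F, impression F = [set x],
  forall e, 0 < e -> exists k, F k `<=` ball x e & forall k, tail_in (F k)].
Proof.
have c0 : Omega (c 0) by apply: cO; rewrite lexx ltr01.
have nOx : ~ Omega x by have [_] := xO; apply: contra_not => Ox; exact: open_nbhs_nbhs.
have d0 : 0 < mdist x (c 0).
  by rewrite mdist_gt0; apply/eqP => h; apply: nOx; rewrite h.
(* The radii start at the distance to [c 0], which thus lies in no [F k]: the inclusion of [F k] in
   [Omega] is strict. *)
pose r (k : nat) := mdist x (c 0) / k.+1%:R.
have r0 k : 0 < r k by rewrite divr_gt0.
have rS k : r k.+1 < r k by rewrite ltr_pM2l// ltf_pV2 ?posrE ?ltr0n// ltr_nat.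
have rle k : r k <= mdist x (c 0) by rewrite ler_pdivrMr// ler_peMr// ?ler1n// ltW.
have rto e : 0 < e -> exists k, r k < e.
  move=> e0; exists (Num.truncn (mdist x (c 0) / e)).
  rewrite ltr_pdivrMr// mulrC -ltr_pdivrMr//.
  exact: truncnS_gt.
have /choice[s sP] k : exists s, 0 < s < 1 /\ forall t, s <= t < 1 ->
    ball x (r k) (c t).
  by have [s h1 h2] := tail_ball (r0 k); exists s.
pose U k := Omega `&` ball x (r k).
have oU k : open (U k) by apply: openI => //; exact: ball_open_metric.
have lcU k z : U k z -> nbhs z (connected_component (U k) z).
  exact: locally_connected.
pose F k := connected_component (U k) (c (s k)).
have FU k : F k `<=` U k by exact: connected_component_sub.
have tF k t : s k <= t < 1 -> F k (c t).
  have [/andP[sk0 sk1] sk] := sP k.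
  (* The image of the tail is connected and stays in [U k], so it lies in a single component. *)
  move=> tk; have : (c @` `[s k, 1[) (c t) by exists t => //; rewrite /= in_itv.
  apply: connected_component_max.
  - by exists (s k) => //; rewrite /= in_itv /= lexx.
  - move=> z [u]; rewrite /= in_itv /= => u1 <-; split; last exact: sk.
    by apply: cO; case/andP: u1 => *; apply/andP; split => //; lra.
  - apply: connected_continuous_connected.
      exact/connected_intervalP/interval_is_interval.
    apply: continuous_subspaceW cc => u /=; rewrite !in_itv /= => /andP[*].
    by apply/andP; split; lra.
have tailF k : tail_in (F k).
  by have [h1 h2] := sP k; exists (s k) => // t; exact: tF.
have clF k : closure (F k) x.
  apply/closure_ballP => e e0.
  have [t /andP[t0 t1] tFe] := tail_inI (tailF k) (tail_ball e0).
  have [] := tFe t; first by rewrite lexx.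
  by rewrite in_ball; exists (c t).
have Iclosure y : impression F y -> y = x.
  move=> Iy; apply/esym/mdist_positivity; apply/eqP; rewrite eq_le mdist_ge0 andbT.
  rewrite leNgt; apply/negP => /rto[k].
  have : closure [set z : X | mdist x z <= r k] y.
    by apply: closureS (Iy k Logic.I) => z /FU[_]; rewrite in_ball => /ltW.
  by move=> /cball_closed /=; lra.
have IF : impression F = [set x].
  by apply/seteqP; split=> y; [exact: Iclosure|move=> -> k _; exact: clF].
(* A boundary point in [Omega] at distance less than [r k] would be in [U k], where components have
   no boundary points. *)
have bF k y : Omega y -> boundary (F k) y -> mdist x y = r k.
  move=> Oy By; apply/eqP; rewrite eq_le; apply/andP; split.
    have [cy _] := By; have : closure [set z : X | mdist x z <= r k] y.
      by apply: closureS cy => z /FU[_]; rewrite in_ball => /ltW.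
    by move=> /cball_closed.
  rewrite leNgt; apply/negP => xy; apply: (boundary_component (lcU k) By).
  by split => //; rewrite in_ball.
exists F; split => //; last first.
  move=> e /rto[k rk]; exists k => y /FU[_]; rewrite !in_ball => h.
  exact: lt_trans rk.
split => //; last 1 first.
- by rewrite IF => y ->.
- move=> k; split.
  + by exists x, (r k) => y /FU[].
  + exact: component_connected.
  + split; first by move=> y /FU[].
    by move=> /(_ _ c0) /FU[_]; rewrite in_ball; have := rle k; lra.
  + by exists x; split => //; exact: clF.
(* A common tail point identifies [F k] as its own component, which must contain the connected set
   [F k.+1]. *)
- move=> k y Fy; have [t /andP[t0 t1] tFF] := tail_inI (tailF k.+1) (tailF k).
  have [Ft1 Ft] : F k.+1 (c t) /\ F k (c t) by apply: tFF; rewrite lexx.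
  rewrite /F (same_connected_component Ft).
  apply: connected_component_max Fy; first exact: Ft1.
    move=> z /FU[Oz]; rewrite in_ball => xz; split => //.
    by rewrite in_ball; exact: lt_trans (rS k).
  exact: component_connected.
(* The two boundaries lie on concentric spheres of different radii. *)
- move=> k; apply: (@lt_le_trans _ _ (r k - r k.+1)%:E).
    by rewrite lte_fin subr_gt0.
  apply: le_set_dist => y z [Oy By] [Oz Bz].
  have := bF _ _ Oy By; have := bF _ _ Oz Bz.
  by have := metric_triangle x y z; lra.
Qed.

End AccessChain.

(** * Curves parameterized by arc length *)

Section TranslateIntegral.
Context {R : realType}.
Implicit Types (a : R) (D : set R) (f : R -> \bar R).

Definition translate a (t : measurableTypeR R) : measurableTypeR R := a + t.

Lemma measurable_translate a : measurable_fun setT (translate a).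
Proof.
apply: continuous_measurable_fun => t.
by apply: cvgD; [exact: cvg_cst|exact: cvg_id].
Qed.

HB.instance Definition _ a :=
  isMeasurableFun.Build _ _ _ _ (translate a) (measurable_translate a).

(** By uniqueness of Lebesgue measure it suffices to compare the lengths of half-open intervals. *)
Lemma lebesgue_measure_translate a D : measurable D ->
  pushforward lebesgue_measure (translate a) D = lebesgue_measure D.
Proof.
move=> mD; apply/esym/lebesgue_measure_unique => //= _ [[u v] _ <-].
rewrite /pushforward /= (_ : _ @^-1` _ = `]u - a, v - a]%classic); last first.
  by apply/seteqP; split=> t /=; rewrite /translate !in_itv /= => /andP[h1 h2];
    apply/andP; split; lra.
by rewrite !lebesgue_measure_itv /= !lte_fin ltrD2r; case: ifP => // _;
  congr EFin; ring.
Qed.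

Lemma ge0_integral_translate a D f : measurable D -> measurable_fun D f ->
  (forall t, D t -> (0 <= f t)%E) ->
  (\int[lebesgue_measure]_(t in D) f t =
   \int[lebesgue_measure]_(t in translate a @^-1` D) f (translate a t))%E.
Proof.
move=> mD mf f0; rewrite -(ge0_integral_pushforward (measurable_translate a))//.
  by apply: eq_measure_integral => A mA _; exact/esym/lebesgue_measure_translate.
by move=> t; rewrite inE; exact: f0.
Qed.

End TranslateIntegral.

Section Curves.
Context {R : realType} {X : completeMetricType R}.
Implicit Types (c : rect_curve X) (g : X -> \bar R) (a b s t : R).

Lemma curve_length_translate_le (f : R -> X) a s t :
  (curve_length s t (fun u => f (a + u)%R) <= curve_length (a + s)%R (a + t)%R f)%E.
Proof.
apply: ge_ereal_sup => _ [l [pl /eqP ll] <-].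
apply: ereal_sup_ubound; exists (map (fun u => a + u) l).
  split; last by rewrite last_map ll.
  rewrite path_map; apply: sub_path pl => u v /=.
  by rewrite ltrD2l.
congr EFin; rewrite size_map; apply: eq_bigr => i _.
have nthE j : nth (a + t) (a + s :: map (fun u => a + u) l) j =
    a + nth t (s :: l) j.
  by rewrite -(map_cons (fun u => a + u)); elim: (s :: l) j => [|v m IH] [|j] /=.
by rewrite !nthE.
Qed.

(** The reverse inequality is the previous one for the translation by [- a]. *)
Lemma curve_length_translate (f : R -> X) a s t :
  curve_length s t (fun u => f (a + u)) = curve_length (a + s) (a + t) f.
Proof.
apply/eqP; rewrite eq_le curve_length_translate_le /=.
have := curve_length_translate_le (fun u => f (a + u)) (- a) (a + s) (a + t).
rewrite !addKr; apply: le_trans; rewrite le_eqVlt; apply/orP; left; apply/eqP.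
by congr curve_length; apply/funext => u; rewrite addNKr.
Qed.

Lemma curve_lip c s t : 0 <= s -> s <= t -> t <= arc_len c ->
  mdist (c s) (c t) <= t - s.
Proof.
move=> s0 st tl; move: (st); rewrite le_eqVlt => /predU1P[->|slt].
  by rewrite mdistxx subrr.
rewrite -lee_fin -(arc_fun_length s0 st tl); apply: ereal_sup_ubound.
exists [:: t]; first exact: itv_partition1.
by rewrite big_nat1.
Qed.

Lemma measurable_curve c g :
  measurable_fun setT (g : borel X -> \bar R) ->
  measurable_fun `[0, arc_len c] (fun t : measurableTypeR R => g (c t)).
Proof.
have mc : measurable_fun `[0, arc_len c] (c : measurableTypeR R -> borel X).
  apply: (@measurability _ _ (measurableTypeR R) (borel X) _ _ (@open X) erefl).
move=> _ [V oV <-].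
have /continuousP/(_ V oV)/open_subspaceP[W oW] := @arc_fun_continuous _ _ c.
rewrite setIC => WE.
rewrite (_ : _ `&` _ = `[0, arc_len c] `&` W); last by rewrite WE setIC.
apply: measurableI; first exact: measurable_itv.
  exact: open_measurable.
move=> mg mD Y mY; have := mc mD (g @^-1` Y); apply.
by rewrite -[_ @^-1` _]setTI; exact: mg.
Qed.

Lemma subcurve_continuous c a b : 0 <= a -> b <= arc_len c ->
  {within `[0, b - a], continuous (fun t => c (a + t))}.
Proof.
move=> a0 bl; apply/subspace_continuousP => t; rewrite /= in_itv /= => /andP[t0 tb].
have inc : `[0, arc_len c]%classic (a + t).
  by rewrite /= in_itv /=; apply/andP; split; lra.
move=> U /nbhs_ballP[e e0 eU].
have [d d0 dc] := within_continuousP (@arc_fun_continuous _ _ c) inc e0.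
apply/nbhs_ballP; exists d => // u tu; rewrite /= in_itv /= => /andP[u0 ub].
apply: eU; rewrite in_ball; apply: dc.
  by rewrite /= in_itv /=; apply/andP; split; lra.
by rewrite opprD addrACA subrr add0r.
Qed.

Lemma subcurve_length c a b s t : 0 <= a -> b <= arc_len c ->
  0 <= s -> s <= t -> t <= b - a ->
  curve_length s t (fun t => c (a + t)) = (t - s)%:E.
Proof.
move=> a0 bl s0 st tb; rewrite curve_length_translate arc_fun_length; last 3 first.
- lra.
- lra.
- lra.
by congr EFin; lra.
Qed.

Section Subcurve.
Variables (c : rect_curve X) (a b : R).
Hypotheses (a0 : 0 <= a) (ab : a < b) (bl : b <= arc_len c).

(** Reparameterized to start at time 0. Applying the gradient inequality, which speaks of end points
    only, to subcurves yields it for all pairs of parameters. *)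
Definition subcurve : rect_curve X := RectCurve
  (etrans (subr_gt0 a b) ab) (subcurve_continuous a0 bl)
  (fun s t => @subcurve_length c a b s t a0 bl).

Lemma subcurve_integral g : borel_nonneg g ->
  curve_integral g subcurve = (\int[lebesgue_measure]_(t in `[a, b]) g (c t))%E.
Proof.
move=> [g0 mg].
have h1 := a0; have h2 := ab; have h3 := bl.
have sub : `[a, b]%classic `<=` `[0, arc_len c]%classic.
  by move=> t /=; rewrite !in_itv /= => /andP[*]; apply/andP; split; lra.
rewrite (@ge0_integral_translate _ a)//; last first.
  apply: measurable_funS sub _; first exact: measurable_itv.
  exact: measurable_curve.
rewrite /curve_integral /=; congr integral.
rewrite /translate.
apply/seteqP; split=> t /=; rewrite !in_itv /= => /andP[*];
  apply/andP; split; lra.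
Qed.

End Subcurve.

End Curves.

(** * Gradients along a curve *)

Lemma le_integral_dominated_lim d (T : measurableType d) (R : realType)
    (m : {measure set T -> \bar R}) (D : set T)
    (k_ : nat -> T -> \bar R) (k g : T -> \bar R) (C : \bar R) :
  measurable D -> (forall n, measurable_fun D (k_ n)) -> measurable_fun D k ->
  (forall t, D t -> (k_ n t) @[n --> \oo] --> k t) ->
  m.-integrable D g -> (forall n t, D t -> 0 <= k_ n t <= g t)%E ->
  (forall n, C <= \int[m]_(t in D) k_ n t)%E -> (C <= \int[m]_(t in D) k t)%E.
Proof.
move=> mD mk_ mk k_k ig k_g Ck.
have [| |_ _ cvgk] := dominated_convergence mD mk_ mk _ ig.
- by apply: aeW => t; exact: k_k.
- by apply: aeW => t n /(k_g n) /andP[k0 kg]; rewrite gee0_abs.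
by apply: (cvge_ge _ cvgk); apply: nearW.
Qed.

Section GradientAlong.
Context {R : realType}.
Variables (F : R -> R) (L : R).
Implicit Types (k : R -> \bar R) (S T : set R) (s t a : R).
Local Notation leb := (@lebesgue_measure R).

(** In effect [F] is absolutely continuous on [0, L] with |F'| <= [k] almost everywhere, phrased
    without derivatives. *)
Definition grad_along k := [/\ measurable_fun `[0, L] k,
  forall t, (0 <= k t)%E, (\int[leb]_(t in `[0%R, L]) k t < +oo)%E &
  forall s t, 0 <= s -> s <= t -> t <= L ->
    ((`|F t - F s|)%:E <= \int[leb]_(r in `[s, t]) k r)%E].

Definition glue S k1 k2 t := if t \in S then k1 t else k2 t.

(* Glueable sets form a sigma-algebra: complements swap k1 and k2, intersections
   glue an already glued gradient, and increasing unions are limits. *)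
Definition glueable S := measurable S /\ forall k1 k2,
  grad_along k1 -> grad_along k2 -> grad_along (glue S k1 k2).

Lemma sub_itv0 s t : 0 <= s -> t <= L -> `[s, t]%classic `<=` `[0, L]%classic.
Proof.
move=> s0 tL r /=; rewrite !in_itv /= => /andP[h1 h2]; apply/andP; split.
  exact: le_trans h1.
exact: le_trans tL.
Qed.

Lemma measurable_glue (D : set R) S k1 k2 : measurable D -> measurable S ->
  measurable_fun D k1 -> measurable_fun D k2 -> measurable_fun D (glue S k1 k2).
Proof.
move=> mD mS m1 m2; apply: measurable_fun_if => //.
- apply: (measurable_fun_bool true); rewrite (_ : _ @^-1` _ = S).
    exact: measurableI.
  by apply/seteqP; split=> t /=; [move=> /set_mem|move=> /mem_set].
- by apply: measurable_funS m1 => //; exact: subIsetl.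
- by apply: measurable_funS m2 => //; exact: subIsetl.
Qed.

Lemma glue_le_add S k1 k2 t : (forall t, 0 <= k1 t)%E -> (forall t, 0 <= k2 t)%E ->
  (glue S k1 k2 t <= k1 t + k2 t)%E.
Proof.
by move=> h1 h2; rewrite /glue; case: ifP => _; [rewrite leeDl|rewrite leeDr].
Qed.

Lemma glue_ge0 S k1 k2 t : (forall t, 0 <= k1 t)%E -> (forall t, 0 <= k2 t)%E ->
  (0 <= glue S k1 k2 t)%E.
Proof. by rewrite /glue; case: ifP. Qed.

Lemma grad_along_add_lty k1 k2 : grad_along k1 -> grad_along k2 ->
  (\int[leb]_(t in `[0%R, L]) (k1 t + k2 t) < +oo)%E.
Proof.
by move=> [m1 p1 i1 _] [m2 p2 i2 _]; rewrite ge0_integralD// lte_add_pinfty.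
Qed.

(** The glued function is dominated by [k1 + k2], so only the bound on increments remains to be
    checked in each case. *)
Lemma grad_along_glue S k1 k2 : measurable S -> grad_along k1 -> grad_along k2 ->
  (forall s t, 0 <= s -> s <= t -> t <= L ->
    ((`|F t - F s|)%:E <= \int[leb]_(r in `[s, t]) glue S k1 k2 r)%E) ->
  grad_along (glue S k1 k2).
Proof.
move=> mS g1 g2 H; have lty := grad_along_add_lty g1 g2.
have [m1 p1 _ _] := g1; have [m2 p2 _ _] := g2.
split => //; [exact: measurable_glue|by move=> t; exact: glue_ge0|].
apply: le_lt_trans lty; apply: ge0_le_integral => //.
- by move=> t _; exact: glue_ge0.
- exact: measurable_glue.
- exact: emeasurable_funD.
- by move=> t _; exact: glue_le_add.
Qed.

Lemma glueableC S : glueable S -> glueable (~` S).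
Proof.
move=> [mS gS]; split=> [|k1 k2 g1 g2]; first exact: measurableC.
rewrite (_ : glue _ _ _ = glue S k2 k1); first exact: gS.
apply/funext => t; rewrite /glue in_setC; by case: (t \in S).
Qed.

Lemma glueableI S T : glueable S -> glueable T -> glueable (S `&` T).
Proof.
move=> [mS gS] [mT gT]; split=> [|k1 k2 g1 g2]; first exact: measurableI.
rewrite (_ : glue _ _ _ = glue S (glue T k1 k2) k2); first exact/gS/g2/gT.
by apply/funext => t; rewrite /glue in_setI; case: (t \in S).
Qed.

Lemma glueableU S T : glueable S -> glueable T -> glueable (S `|` T).
Proof.
move=> gS gT; rewrite -(setCK (S `|` T)) setCU.
by apply: glueableC; apply: glueableI; exact: glueableC.
Qed.

Lemma glueable0 : glueable set0.
Proof.
split=> // k1 k2 _ g2; rewrite (_ : glue _ _ _ = k2)//.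
by apply/funext => t; rewrite /glue in_set0.
Qed.

Lemma glueable_bigcup_nondecreasing (A : nat -> set R) :
  (forall i, glueable (A i)) -> (forall i j, (i <= j)%N -> A i `<=` A j) ->
  glueable (\bigcup_i A i).
Proof.
move=> gA ndA; have mU : measurable (\bigcup_i A i).
  by apply: bigcup_measurable => i _; have [] := gA i.
split=> // k1 k2 g1 g2; apply: grad_along_glue => // s t s0 st tL.
have [m1 p1 _ _] := g1; have [m2 p2 _ _] := g2.
have sub := sub_itv0 s0 tL.
have mS k : measurable_fun `[0, L] k -> measurable_fun `[s, t] k.
  by apply: measurable_funS => //; exact: measurable_itv.
have intk : leb.-integrable `[s, t] (fun r => k1 r + k2 r)%E.
  apply/integrableP; split; first by apply: emeasurable_funD; exact: mS.
  apply: le_lt_trans (grad_along_add_lty g1 g2).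
  under eq_integral do rewrite gee0_abs ?adde_ge0//.
  apply: ge0_subset_integral => //; first exact: emeasurable_funD.
  by move=> r _; rewrite adde_ge0.
(* At each point the functions glued along [A n] are eventually constant in [n], and all are
   dominated by [k1 + k2]. *)
apply: (@le_integral_dominated_lim _ _ _ leb `[s, t] (fun n => glue (A n) k1 k2) _
  (fun r => k1 r + k2 r)%E) => //.
- move=> n; apply: mS; apply: measurable_glue => //; by have [] := gA n.
- by apply: mS; apply: measurable_glue => //; exact: measurable_itv.
- move=> r _; have [[i _ Air]|nU] := pselect ((\bigcup_i A i) r).
    apply: cvg_near_cst; exists i => // j /= ij.
    by rewrite /glue !mem_set//; [exists i|exact: ndA Air].
  apply: cvg_near_cst; apply: nearW => n.
  rewrite /glue !memNset//; by apply: contra_not nU => ?; exists n.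
- by move=> n r _; rewrite glue_ge0 ?glue_le_add.
- by move=> n; have [_ /(_ _ _ g1 g2)[_ _ _ ]] := gA n; exact.
Qed.

Lemma glueable_bigcup (A : nat -> set R) :
  (forall i, glueable (A i)) -> glueable (\bigcup_i A i).
Proof.
move=> gA; rewrite -bigcup_bigsetU_bigcup.
apply: glueable_bigcup_nondecreasing => [n|i j ij].
  elim: n.+1 => [|m IH]; first by rewrite big_ord0; exact: glueable0.
  by rewrite big_ord_recr; exact: glueableU.
exact: subset_bigsetU.
Qed.

(** An interval containing [a] is cut there: [k2] controls the increment on the left, [k1] that on
    the right, and the triangle inequality joins them. *)
Lemma glueable_ray a : glueable `]a, +oo[%classic.
Proof.
split=> [|k1 k2 g1 g2]; first exact: measurable_itv.
apply: grad_along_glue => // s t s0 st tL.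
have [m1 p1 _ h1] := g1; have [m2 p2 _ h2] := g2.
have mG : measurable_fun `[s, t] (glue `]a, +oo[%classic k1 k2).
  apply: measurable_funS (sub_itv0 s0 tL) _; first exact: measurable_itv.
  by apply: measurable_glue => //; exact: measurable_itv.
have glue1 r : a < r -> glue `]a, +oo[%classic k1 k2 r = k1 r.
  by move=> ar; rewrite /glue mem_set//= in_itv /= ar.
have glue2 r : r <= a -> glue `]a, +oo[%classic k1 k2 r = k2 r.
  move=> ra; rewrite /glue memNset//= in_itv /= andbT => /(le_lt_trans ra).
  by rewrite ltxx.
have [ta|at_] := leP t a.
  rewrite [leRHS](_ : _ = \int[leb]_(r in `[s, t]) k2 r)%E; first exact: h2.
  apply: eq_integral => r; rewrite inE /= in_itv /= => /andP[_ rt].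
  by apply: glue2; exact: le_trans ta.
have [as_|sa] := ltP a s.
  rewrite [leRHS](_ : _ = \int[leb]_(r in `[s, t]) k1 r)%E; first exact: h1.
  apply: eq_integral => r; rewrite inE /= in_itv /= => /andP[sr _].
  by apply: glue1; exact: lt_le_trans sr.
rewrite (@itv_bndbnd_setU _ _ (BLeft s) (BRight a)) ?bnd_simp//; last exact: ltW.
have msub (i : interval R) : [set` i] `<=` `[s, t]%classic ->
    measurable_fun [set` i] (glue `]a, +oo[%classic k1 k2).
  by move=> ist; apply: measurable_funS mG => //; exact: measurable_itv.
rewrite ge0_integral_setU//; last 3 first.
- by rewrite -itv_bndbnd_setU ?bnd_simp// ltW.
- by move=> r _; exact: glue_ge0.
- apply/disj_setPS => r [] /=; rewrite !in_itv /= => /andP[_ h] /andP[h' _].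
  by move: (le_lt_trans h h'); rewrite ltxx.
rewrite [X in (X + _)%E](_ : _ = \int[leb]_(r in `[s, a]) k2 r)%E; last first.
  apply: eq_integral => r; rewrite inE /= in_itv /= => /andP[_ ra]; exact: glue2.
rewrite [X in (_ + X)%E](_ : _ = \int[leb]_(r in `]a, t]) k1 r)%E; last first.
  apply: eq_integral => r; rewrite inE /= in_itv /= => /andP[ar _]; exact: glue1.
rewrite integral_itv_obnd_cbnd; last first.
  apply: measurable_funS m1 => // r /=; rewrite !in_itv /= => /andP[ar rt].
  rewrite (le_trans rt tL) andbT; apply: le_trans s0 _.
  by apply: le_trans sa _; exact: ltW.
have aL : a <= L by apply: le_trans tL; exact: ltW.
have a0 : 0 <= a by exact: le_trans sa.
apply: le_trans (leeD (h2 _ _ s0 sa aL) (h1 _ _ a0 (ltW at_) tL)).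
rewrite -EFinD lee_fin [leRHS]addrC; apply: le_trans (ler_normD _ _).
by rewrite subrKA.
Qed.

(** Open rays generate the Borel sets, and glueable sets form a sigma-algebra. *)
Lemma glueable_measurable S : measurable S -> glueable S.
Proof.
have sG : sigma_algebra setT glueable.
  split; first exact: glueable0.
    by move=> A gA; rewrite setTD; exact: glueableC.
  exact: glueable_bigcup.
rewrite [X in X -> _](_ : _ = (@ocitv R).-sigma.-measurable S)//.
rewrite RGenOInfty.measurableE; apply: smallest_sub => //.
by move=> _ [a ->]; exact: glueable_ray.
Qed.

(* The minimum is k1 on the measurable set where k1 <= k2, and k2 elsewhere. *)
Lemma grad_along_min k1 k2 : grad_along k1 -> grad_along k2 ->
  grad_along (fun t => Order.min (k1 t) (k2 t)).
Proof.
move=> g1 g2; have [m1 p1 _ _] := g1; have [m2 p2 _ _] := g2.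
pose S := `[0, L]%classic `&` [set t | k1 t <= k2 t]%E.
have mS : measurable S.
  by apply: emeasurable_fun_le => //; exact: measurable_itv.
have [mG _ lG hG] := (glueable_measurable mS).2 _ _ g1 g2.
have GE t : t \in `[0, L]%classic -> glue S k1 k2 t = Order.min (k1 t) (k2 t).
  rewrite inE => t0L; rewrite /glue; case: ifPn => [|].
    by rewrite inE => -[_ /= h]; rewrite min_l.
  by rewrite notin_setE => nS; rewrite min_r// leNgt; apply/negP => /ltW h; exact: nS.
split.
- by apply: eq_measurable_fun mG => t /GE.
- by move=> t; rewrite le_min p1 p2.
- rewrite [ltLHS](_ : _ = \int[leb]_(t in `[0%R, L]) glue S k1 k2 t)%E//.
  by apply: eq_integral => t /GE.
move=> s t s0 st tL.
rewrite [leRHS](_ : _ = \int[leb]_(r in `[s, t]) glue S k1 k2 r)%E; first exact: hG.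
apply: eq_integral => r; rewrite inE => rst; apply/esym/GE; rewrite inE.
exact: (sub_itv0 s0 tL rst).
Qed.

(** Dominated convergence on each subinterval, with the integrable bound [k_ 0]. *)
Lemma grad_along_lim (k_ : nat -> R -> \bar R) k :
  (forall n, grad_along (k_ n)) ->
  (forall n t, k_ n t <= k_ 0%N t)%E ->
  (forall t, (k_ n t) @[n --> \oo] --> k t) -> grad_along k.
Proof.
move=> gk k0 kk; have [m0 p0 i0 _] := gk 0%N.
have mk : measurable_fun `[0, L] k.
  by apply: (emeasurable_fun_cvg k_) => [n|t _]; [have [] := gk n|exact: kk].
have pk t : (0 <= k t)%E.
  by apply: (cvge_ge _ (kk t)); apply: nearW => n; have [] := gk n.
have kk0 t : (k t <= k_ 0%N t)%E.
  by apply: (cvge_le _ (kk t)); apply: nearW => n.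
split => //.
  by apply: le_lt_trans i0; apply: ge0_le_integral.
move=> s t s0 st tL; have sub := sub_itv0 s0 tL.
have mS g : measurable_fun `[0, L] g -> measurable_fun `[s, t] g.
  by apply: measurable_funS => //; exact: measurable_itv.
have intk : leb.-integrable `[s, t] (k_ 0%N).
  apply/integrableP; split; first exact: mS.
  apply: le_lt_trans i0; under eq_integral do rewrite gee0_abs//.
  exact: ge0_subset_integral.
apply: (@le_integral_dominated_lim _ _ _ leb `[s, t] k_ _ (k_ 0%N)) => //.
- by move=> n; apply: mS; have [] := gk n.
- exact: mS.
- by move=> n r _; rewrite k0 andbT; have [] := gk n.
- by move=> n; have [_ _ _] := gk n; exact.
Qed.

End GradientAlong.

(** * Existence of minimal weak upper gradients *)

(** The integral of a nonnegative function is a supremum over simple functions below it, and a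
    larger function has more of these. This covers gradients measurable only for the completion of
    [mu]. *)
Lemma ge0_le_integral_nonmeasurable d (T : measurableType d) (R : realType)
    (m : {measure set T -> \bar R}) (D : set T) (f g : T -> \bar R) :
  (forall x, D x -> 0 <= f x)%E -> (forall x, D x -> f x <= g x)%E ->
  (\int[m]_(x in D) f x <= \int[m]_(x in D) g x)%E.
Proof.
move=> f0 fg; rewrite integral_mkcond [leRHS]integral_mkcond.
have fg' x : ((f \_ D) x <= (g \_ D) x)%E.
  by rewrite !patchE; case: ifPn => //; rewrite inE => /fg.
have f0' x : (0 <= (f \_ D) x)%E.
  by rewrite patchE; case: ifPn => //; rewrite inE => /f0.
rewrite !ge0_integralTE//; last by move=> x; exact: le_trans (fg' x).
apply: le_ereal_sup => _ [h /= hf <-]; exists h => //= x.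
exact: le_trans (hf x) _.
Qed.

Section StrongGradients.
Context {R : realType} {X : completeMetricType R}.
Variables (mu : {measure set (borel X) -> \bar R}) (p : R) (u : X -> R).
Implicit Types (g rho : X -> \bar R) (c : rect_curve X).
Local Notation energy := (p_energy mu p).

Lemma borel_mu_measurable g : measurable_fun setT (g : borel X -> \bar R) ->
  mu_measurable mu g.
Proof.
move=> mg _ Y mY; rewrite setTI; apply: sub_sigma_algebra.
exists (g @^-1` Y); first by rewrite -[X in measurable X]setTI; exact: mg.
exists set0; first by exists set0; split; rewrite ?measure0.
by rewrite setU0.
Qed.

Lemma p_energyE g : (forall x, 0 <= g x)%E ->
  energy g = (\int[mu]_x (g x `^ p))%E.
Proof. by move=> g0; apply: eq_integral => x _; rewrite gee0_abs. Qed.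

Lemma measurable_poweR_comp g : measurable_fun setT (g : borel X -> \bar R) ->
  measurable_fun setT (fun x : borel X => g x `^ p)%E.
Proof. by move=> mg; apply: (measurableT_comp (measurable_poweR p)). Qed.

Lemma poweR_le (x y : \bar R) : 0 <= p -> (0 <= x)%E -> (x <= y)%E ->
  (x `^ p <= y `^ p)%E.
Proof.
move=> p0 x0 xy; apply: gt0_ler_poweR => //.
  by rewrite in_itv /= x0 leey.
by rewrite in_itv /= leey (le_trans x0 xy).
Qed.

Lemma p_energy_le g1 g2 : 0 <= p -> (forall x, 0 <= g1 x)%E ->
  (forall x, g1 x <= g2 x)%E -> (energy g1 <= energy g2)%E.
Proof.
move=> p0 g10 g12; apply: ge0_le_integral_nonmeasurable => x _.
  exact: poweR_ge0.
by apply: poweR_le => //; rewrite !gee0_abs// (le_trans (g10 x)).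
Qed.

Lemma curve_integral_ge0 g c : (forall x, 0 <= g x)%E -> (0 <= curve_integral g c)%E.
Proof. by move=> g0; apply: integral_ge0 => t _. Qed.

Lemma curve_integral_le g1 g2 c : (forall x, 0 <= g1 x)%E ->
  (forall x, g1 x <= g2 x)%E -> (curve_integral g1 c <= curve_integral g2 c)%E.
Proof. by move=> g0 g12; apply: ge0_le_integral_nonmeasurable => t _. Qed.

(* rho = (sum_n b_n rho_n^p)^(1/p) with weights making the energies summable. *)
Lemma common_exceptional (rho_ : nat -> X -> \bar R) : 0 < p ->
  (forall n, borel_nonneg (rho_ n)) -> (forall n, energy (rho_ n) < +oo)%E ->
  exists rho, [/\ borel_nonneg rho, (energy rho < +oo)%E &
    forall c, (curve_integral rho c < +oo)%E ->
      forall n, (curve_integral (rho_ n) c < +oo)%E].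
Proof.
move=> p0 brho frho.
have p_neq0 : p != 0 by rewrite gt_eqF.
have en n : energy (rho_ n) = (fine (energy (rho_ n)))%:E.
  by rewrite fineK// ge0_fin_numE//; apply: integral_ge0 => x _; exact: poweR_ge0.
have e0 n : 0 <= fine (energy (rho_ n)).
  by apply: fine_ge0; apply: integral_ge0 => x _; exact: poweR_ge0.
pose b n : R := (1 / (2 ^ n.+1)%:R) / (1 + fine (energy (rho_ n))).
have b0 n : 0 < b n by rewrite divr_gt0 ?divr_gt0 ?ltr0n ?expn_gt0// ltr_pwDl.
pose f n x : \bar R := ((b n)%:E * (rho_ n x `^ p))%E.
have f0 n x : (0 <= f n x)%E by rewrite mule_ge0 ?poweR_ge0// lee_fin ltW.
have mf n : measurable_fun setT (f n : borel X -> \bar R).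
  apply: emeasurable_funM => //; apply: measurable_poweR_comp.
  by have [] := brho n.
pose S x : \bar R := (\sum_(0 <= n <oo) f n x)%E.
have S0 x : (0 <= S x)%E by apply: nneseries_ge0 => n _ _; exact: f0.
have mS : measurable_fun setT (S : borel X -> \bar R).
  exact: ge0_emeasurable_sum.
pose rho x := (S x `^ p^-1)%E.
have rho0 x : (0 <= rho x)%E by exact: poweR_ge0.
have brho' : borel_nonneg rho.
  by split => //; apply: (measurableT_comp (measurable_poweR p^-1)).
exists rho; split => //.
- rewrite p_energyE//.
  under eq_integral => x _ do rewrite /rho -poweRrM mulVf// poweRe1//.
  rewrite integral_nneseries//; apply: (@le_lt_trans _ _ 1%:E); last exact: ltry.
  apply: le_trans (epsilon_trick0 xpredT ler01).
  apply: lee_nneseries => [n _ _|n _]; first exact: integral_ge0.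
  rewrite ge0_integralZl_EFin//; last 3 first.
  + by move=> x _; exact: poweR_ge0.
  + by apply: measurable_poweR_comp; have [] := brho n.
  + exact: ltW.
  rewrite -p_energyE; last by have [] := brho n.
  rewrite en -EFinM lee_fin /b mulrAC ler_pdivrMr ?ltr_pwDl//.
  by apply: ler_wpM2l; rewrite ?divr_ge0// lerDr.
- move=> c crho n; have [rn0 mrn] := brho n.
  have bp : (0 < (b n) `^ p^-1)%R by exact: powR_gt0.
  (* A single term is below the series [S]; its p-th root is a positive multiple of [rho_ n]. *)
  have le_rho x : (((b n) `^ p^-1)%:E * rho_ n x <= rho x)%E.
    have -> : (((b n) `^ p^-1)%:E * rho_ n x = f n x `^ p^-1)%E.
      rewrite poweRM ?poweR_ge0 ?lee_fin ?(ltW (b0 n))// -poweRrM mulfV//.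
      by rewrite poweRe1.
    apply: gt0_ler_poweR.
    + by rewrite invr_ge0 ltW.
    + by rewrite in_itv /= f0 leey.
    + by rewrite in_itv /= leey S0.
    + apply: (@le_trans _ _ (\sum_(0 <= k < n.+1) f k x)%E).
        by rewrite big_nat_recr//= leeDr// sume_ge0.
      by apply: nneseries_lim_ge => k _ _; exact: f0.
  have : (((b n) `^ p^-1)%:E * curve_integral (rho_ n) c < +oo)%E.
    apply: le_lt_trans crho.
    rewrite /curve_integral -ge0_integralZl_EFin//.
    + by apply: ge0_le_integral_nonmeasurable => t _ //; rewrite mule_ge0// lee_fin ltW.
    + exact: measurable_curve.
    + exact: ltW.
  case: (curve_integral (rho_ n) c) => [r| |] //.
    by move=> _; exact: ltry.
  by rewrite gt0_muley ?lte_fin.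
Qed.

Lemma common_exceptional2 rho1 rho2 : 0 < p ->
  borel_nonneg rho1 -> borel_nonneg rho2 ->
  (energy rho1 < +oo)%E -> (energy rho2 < +oo)%E ->
  exists rho, [/\ borel_nonneg rho, (energy rho < +oo)%E &
    forall c, (curve_integral rho c < +oo)%E ->
      (curve_integral rho1 c < +oo)%E /\ (curve_integral rho2 c < +oo)%E].
Proof.
move=> p0 b1 b2 e1 e2.
have [||rho [br er H]] := @common_exceptional
  (fun n => if n is 0%N then rho1 else rho2) p0; [by case|by case|].
by exists rho; split => // c /H {}H; split; [exact: (H 0%N)|exact: (H 1%N)].
Qed.

(* Unlike weak_upper_gradient, this constrains all subcurves of p-almost every
   curve, and g is Borel. *)
Definition strong_gradient g := [/\ borel_nonneg g, (energy g < +oo)%E &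
  exists rho, [/\ borel_nonneg rho, (energy rho < +oo)%E &
    forall c, (curve_integral rho c < +oo)%E ->
      grad_along (fun t => u (c t)) (arc_len c) (fun t => g (c t))]].

(** A density excluding [Gamma] also excludes every curve having a subcurve in [Gamma]. Adding [g]
    to the exceptional densities makes its integral along the remaining curves finite. *)
Lemma weak_strong_gradient g : 0 < p -> borel_nonneg g -> (energy g < +oo)%E ->
  weak_upper_gradient mu p (EFin \o u) g -> strong_gradient g.
Proof.
move=> p0 bg eg [_ _ [Gamma [rho0 [br0 er0 Hr0]] HG]]; split => //.
have [rho [br er Hr]] := common_exceptional2 p0 br0 bg er0 eg.
exists rho; split => // c /Hr[cr0 cg]; have [g0 mg] := bg.
split => //; first exact: measurable_curve.
move=> s t s0; rewrite le_eqVlt => /predU1P[->|st] tl.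
  by rewrite subrr normr0 integral_ge0.
pose d := subcurve s0 st tl.
have nGd : ~ Gamma d.
  move=> /Hr0; rewrite subcurve_integral// => h; suff : (+oo < +oo :> \bar R)%E by [].
  rewrite -{1}h; apply: le_lt_trans cr0; have [r00 mr0] := br0.
  apply: ge0_subset_integral => //; first exact: measurable_curve.
  exact: sub_itv0.
have := HG _ nGd; rewrite /upper_gradient_along /= subcurve_integral//.
by rewrite addr0 [s + _]addrC subrK distrC.
Qed.

Lemma strong_weak_gradient g : strong_gradient g ->
  weak_upper_gradient mu p (EFin \o u) g.
Proof.
move=> [[g0 mg] eg [rho [br er Hr]]]; split => //.
- exact: borel_mu_measurable.
- exists [set c | curve_integral rho c = +oo%E]; first by exists rho; split.
  move=> c /eqP nc; have crho : (curve_integral rho c < +oo)%E by rewrite ltey.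
  have [_ _ _ H] := Hr _ crho; rewrite /upper_gradient_along /= distrC.
  by apply: H => //; exact/ltW/arc_len_gt0.
Qed.

Lemma strong_gradient_min g1 g2 : 0 < p -> strong_gradient g1 -> strong_gradient g2 ->
  strong_gradient (fun x => Order.min (g1 x) (g2 x)).
Proof.
move=> p0 [[g10 m1] e1 [r1 [br1 er1 H1]]] [[g20 m2] e2 [r2 [br2 er2 H2]]].
split.
- split; first by move=> x; rewrite le_min g10 g20.
  exact: measurable_mine.
- apply: le_lt_trans e1; apply: p_energy_le; first exact: ltW.
    by move=> x; rewrite le_min g10 g20.
  by move=> x; rewrite ge_min lexx.
- have [rho [br er Hr]] := common_exceptional2 p0 br1 br2 er1 er2.
  exists rho; split => // c /Hr[c1 c2].
  exact: grad_along_min (H1 _ c1) (H2 _ c2).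
Qed.

(** One density serves as exceptional density for all [g_ n] at once; along each remaining curve the
    limit is dominated by [g_ 0]. *)
Lemma strong_gradient_lim (g_ : nat -> X -> \bar R) g : 0 < p ->
  (forall n, strong_gradient (g_ n)) ->
  (forall n x, g_ n x <= g_ 0%N x)%E ->
  (forall x, (g_ n x) @[n --> \oo] --> g x) -> strong_gradient g.
Proof.
move=> p0 sg g0 gg; have [[g00 m0] e0 _] := sg 0%N.
have gp x : (0 <= g x)%E.
  by apply: (cvge_ge _ (gg x)); apply: nearW => n; have [[]] := sg n.
have gle x : (g x <= g_ 0%N x)%E.
  by apply: (cvge_le _ (gg x)); apply: nearW => n.
have mg : measurable_fun setT (g : borel X -> \bar R).
  apply: (emeasurable_fun_cvg (g_ : nat -> borel X -> \bar R)) => [n|x _]; last exact: gg.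
  by have [[]] := sg n.
split => //.
  by apply: le_lt_trans e0; apply: p_energy_le => //; exact: ltW.
have /choice[rho_ Hrho] n : exists rho, [/\ borel_nonneg rho, (energy rho < +oo)%E &
  forall c, (curve_integral rho c < +oo)%E ->
    grad_along (fun t => u (c t)) (arc_len c) (fun t => g_ n (c t))].
  by have [_ _ ] := sg n.
have [||rho [br er Hr]] := @common_exceptional rho_ p0.
- by move=> n; have [] := Hrho n.
- by move=> n; have [] := Hrho n.
exists rho; split => // c /Hr cr.
apply: (@grad_along_lim _ _ _ (fun n t => g_ n (c t))) => //.
by move=> n; have [_ _] := Hrho n; apply.
Qed.

End StrongGradients.

(** Sets squeezed in this way between measurable sets form a sigma-algebra containing the generators
    of the completion. *)
Lemma completed_sandwich d (T : measurableType d) (R : realType)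
    (mu : {measure set T -> \bar R}) (S : set T) :
  (completed_algebra_gen mu).-sigma.-measurable S ->
  exists A N, [/\ measurable A, measurable N, mu N = 0, A `<=` S & S `<=` A `|` N].
Proof.
pose G S := exists A N,
  [/\ measurable A, measurable N, mu N = 0, A `<=` S & S `<=` A `|` N].
suff : <<s completed_algebra_gen mu >> `<=` G by apply.
apply: smallest_sub; last first.
  move=> _ [A mA [M [N [mN N0 MN]]] <-]; exists A, N.
  by split=> //; exact: setUS.
split.
- by exists set0, set0; split; rewrite ?measure0.
- move=> B [A [N [mA mN N0 AB BAN]]]; rewrite setTD.
  exists (~` (A `|` N)), N; split => //.
  + exact/measurableC/measurableU.
  + exact: subsetC.
  + move=> x nB; have [Nx|nN] := pselect (N x); first by right.
    by left => -[/AB|].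
- move=> B /choice[A /choice[N H]].
  have mN : measurable (\bigcup_n N n).
    by apply: bigcup_measurable => n _; have [] := H n.
  exists (\bigcup_n A n), (\bigcup_n N n); split => //.
  + by apply: bigcup_measurable => n _; have [] := H n.
  + apply: measure_negligible => //; apply: negligible_bigcup => n.
    by have [] := H n; exists (N n); split.
  + by apply: subset_bigcup => n _; have [] := H n.
  + move=> x [n _ Bx]; have [_ _ _ _ /(_ x Bx)] := H n.
    by case=> ?; [left|right]; exists n.
Qed.

(** * Borel representatives and minimization of the energy *)

Section MinimalGradient.
Context {R : realType} {X : completeMetricType R}.
Variables (mu : {measure set (borel X) -> \bar R}) (p : R) (u : X -> R).
Implicit Types (g rho : X -> \bar R) (c : rect_curve X).
Local Notation energy := (p_energy mu p).

(* The negligible parts of the rational superlevel sets are absorbed in one null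
   Borel set N, outside of which g is Borel. *)
Lemma borel_representative g : (forall x, 0 <= g x)%E -> mu_measurable mu g ->
  exists2 N : set (borel X), measurable N /\ mu N = 0 &
    forall v : \bar R, measurable_fun setT
      (fun x : borel X => if x \in N then v else g x).
Proof.
move=> g0 mg.
have level (q : rat) : exists AN : set (borel X) * set (borel X),
    [/\ measurable AN.1, measurable AN.2, mu AN.2 = 0,
     AN.1 `<=` g @^-1` `](ratr q)%:E, +oo[ &
     g @^-1` `](ratr q)%:E, +oo[ `<=` AN.1 `|` AN.2].
  have := mg measurableT `](ratr q)%:E, +oo[%classic (emeasurable_itv _).
  by rewrite setTI => /completed_sandwich[A [N h]]; exists (A, N).
have /choice[AN HAN] := level.
pose N := \bigcup_(n in [set: nat]) if unpickle n is Some q then (AN q).2 else set0.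
have mN : measurable N.
  by apply: bigcup_measurable => n _; case: unpickle => // q; have [] := HAN q.
have N0 : mu N = 0.
  apply: measure_negligible => //; apply: negligible_bigcup => n.
  case: unpickle => [q|]; last exact: negligible_set0.
  by have [] := HAN q; exists (AN q).2; split.
have ANN q : (AN q).2 `<=` N.
  by move=> x Nx; exists (pickle q); [exact: Logic.I|rewrite pickleK].
exists N; first by split.
move=> v.
pose w (x : borel X) := if x \in N then v else g x.
have Nn x : ~ N x -> w x = g x by move=> nN; rewrite /w memNset.
have Ny x : N x -> w x = v by move=> nN; rewrite /w mem_set.
have mrat (q : rat) : measurable (w @^-1` `](ratr q)%:E, +oo[).
  rewrite (_ : _ @^-1` _ = ((AN q).1 `\` N) `|`
      (N `&` [set _ | (ratr q)%:E < v])%E); last first.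
    have [_ _ _ sub1 sub2] := HAN q.
    apply/seteqP; split=> x /=; rewrite in_itv /= andbT.
      have [Nx|nx] := pselect (N x); first by rewrite Ny//; right.
      rewrite Nn// => qg; left; split => //.
      have [|//|/ANN] := sub2 x; last by move=> /nx.
      by rewrite /= in_itv /= andbT.
    move=> [[Ax nx]|[Nx qv]]; last by rewrite Ny.
    by rewrite Nn//; have := sub1 x Ax; rewrite /= in_itv /= andbT.
  have [mA _ _ _ _] := HAN q.
  apply: measurableU; first exact: measurableD.
  apply: measurableI => //.
  case: ((ratr q)%:E < v)%E.
    by rewrite (_ : [set _ | _] = setT)//; apply/seteqP; split.
  by rewrite (_ : [set _ | _] = set0)//; apply/seteqP; split.
apply: (measurability (@ErealGenOInfty.G R)).
  exact: ErealGenOInfty.measurableE.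
move=> _ [_ [r ->] <-]; rewrite setTI.
rewrite (_ : _ @^-1` _ = \bigcup_q
    (if (r < ratr q)%R then w @^-1` `](ratr q)%:E, +oo[ else set0)).
  apply: bigcupT_measurable_rat => q; case: ifP => _; first exact: mrat.
  exact: measurable0.
apply/seteqP; split=> x /=; rewrite -/(w x).
  rewrite in_itv /= -/(w x) andbT => rw.
  have [q rq qw] : exists2 q : rat, r < ratr q & ((ratr q)%:E < w x)%E.
    move: rw; case: (w x) => [s| |] //.
      by rewrite lte_fin => /rat_in_itvoo[q]; rewrite in_itv /= => /andP[h1 h2]; exists q.
    move=> _; have /rat_in_itvoo[q] : r < r + 1 by rewrite ltrDl.
    by rewrite in_itv /= => /andP[h1 h2]; exists q => //; exact: ltry.
  by exists q; [exact: Logic.I|rewrite rq /= in_itv /= andbT].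
move=> [q _]; case: ifP => // rq.
rewrite /= !in_itv /= !andbT; apply: lt_trans.
by rewrite lte_fin.
Qed.

(** The value +oo on the null set keeps [g1] above [g] everywhere, so the inequality along curves
    survives. The value 0 gives [g2], below [g], which bounds the common energy. *)
Lemma borel_majorant g : 0 < p -> (energy g < +oo)%E ->
  weak_upper_gradient mu p (EFin \o u) g ->
  exists g', strong_gradient mu p u g' /\ {ae mu, forall x, g x = g' x}.
Proof.
move=> p0 eg [g0 mg [Gamma eG HG]].
have [N [mN N0] mgN] := borel_representative g0 mg.
pose g1 x : \bar R := if x \in N then +oo%E else g x.
pose g2 x : \bar R := if x \in N then 0%E else g x.
have g10 x : (0 <= g1 x)%E by rewrite /g1; case: ifP.
have g20 x : (0 <= g2 x)%E by rewrite /g2; case: ifP.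
have gg1 x : (g x <= g1 x)%E by rewrite /g1; case: ifP => // _; exact: leey.
have g2g x : (g2 x <= g x)%E by rewrite /g2; case: ifP.
have e12 : energy g1 = energy g2.
  rewrite !p_energyE//; apply: ae_eq_integral => //.
  - by apply: measurable_poweR_comp; exact: mgN.
  - by apply: measurable_poweR_comp; exact: mgN.
  - exists N; split => // x /= h; apply: contrapT => nN; apply: h => _.
    by rewrite /g1 /g2 memNset.
have e1 : (energy g1 < +oo)%E.
  by rewrite e12; apply: le_lt_trans eg; apply: p_energy_le => //; exact: ltW.
exists g1; split; last first.
  exists N; split => // x /= h; apply: contrapT => nN; apply: h.
  by rewrite /g1 memNset.
have b1 : borel_nonneg g1 by split => //; exact: mgN.
apply: weak_strong_gradient => //; split => //.
  by apply: borel_mu_measurable; have [] := b1.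
exists Gamma => // c /HG; rewrite /upper_gradient_along /=.
by move=> h; apply: le_trans h _; exact: curve_integral_le.
Qed.

Lemma poweR_inj (x y : \bar R) : 0 < p -> (0 <= x)%E -> (0 <= y)%E ->
  (x `^ p = y `^ p)%E -> x = y.
Proof.
move=> p0 x0 y0 /(congr1 (fun z => z `^ p^-1)%E).
by rewrite -!poweRrM mulfV ?gt_eqF// !poweRe1.
Qed.

(** The nonnegative difference of the p-th powers has integral zero, because the energies are equal
    and finite. *)
Lemma p_energy_eq_ae g h : 0 < p -> borel_nonneg g -> borel_nonneg h ->
  (forall x, g x <= h x)%E -> (energy h < +oo)%E -> (energy h <= energy g)%E ->
  {ae mu, forall x, g x = h x}.
Proof.
move=> p0 [g0 mg] [h0 mh] gh eh ehg.
have egh : (energy g <= energy h)%E by apply: p_energy_le => //; exact: ltW.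
have mgp := measurable_poweR_comp p mg; have mhp := measurable_poweR_comp p mh.
(* Where both powers are +oo their difference is -oo by convention; the maximum turns it into 0. *)
pose d (x : borel X) := Order.max (h x `^ p - g x `^ p)%E 0%E.
have d0 x : (0 <= d x)%E by rewrite le_max lexx orbT.
have hgd x : (h x `^ p = g x `^ p + d x)%E.
  have := poweR_le (ltW p0) (g0 x) (gh x); rewrite /d.
  have := poweR_ge0 (g x) p; case: (g x `^ p)%E => [r| |] //.
    by move=> _ ?; rewrite max_l ?sube_ge0// addeC subeK.
  move=> _; rewrite leye_eq => /eqP ->.
  by have -> : (+oo - +oo = -oo :> \bar R)%E by []; rewrite max_r ?leNye.
have md : measurable_fun setT d.
  by apply: measurable_maxe => //; exact: emeasurable_funB.
have : (\int[mu]_x d x = 0)%E.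
  have : energy h = (energy g + \int[mu]_x d x)%E.
    rewrite !p_energyE//; under eq_integral => x _ do rewrite hgd.
    by rewrite ge0_integralD// => x _; exact: poweR_ge0.
  have -> : energy h = energy g by apply/eqP; rewrite eq_le ehg egh.
  have gfin : energy g \is a fin_num.
    rewrite ge0_fin_numE ?(le_lt_trans egh eh)//.
    by apply: integral_ge0 => x _; exact: poweR_ge0.
  move: gfin; case: (energy g) => // r _; case: integral => [s| |] //= [] rs.
  by congr EFin; lra.
under eq_integral => x _ do rewrite -(gee0_abs (d0 x)).
move=> /(ae_eq_integral_abs _ measurableT md); apply: filterS => x /(_ Logic.I) dx.
by apply: poweR_inj => //; rewrite hgd dx adde0.
Qed.

Fixpoint running_min (g_ : nat -> X -> \bar R) n x : \bar R :=
  if n is n'.+1 then Order.min (running_min g_ n' x) (g_ n x) else g_ 0%N x.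

(** Running minima of a minimizing sequence decrease to a strong gradient [h] of least energy. *)
Lemma minimal_gradient_exists g0 : 0 < p -> strong_gradient mu p u g0 ->
  exists g, strong_gradient mu p u g /\
    minimal_weak_upper_gradient mu p (EFin \o u) g.
Proof.
move=> p0 sg0.
pose V := [set energy g | g in strong_gradient mu p u].
have V0 : lbound V 0%E.
  by move=> _ [g _ <-]; apply: integral_ge0 => x _; exact: poweR_ge0.
have m0 : (0 <= ereal_inf V)%E by exact: le_ereal_inf_tmp.
have mfin : ereal_inf V \is a fin_num.
  rewrite ge0_fin_numE//; have [_ e0 _] := sg0; apply: le_lt_trans e0.
  by apply: ereal_inf_lbound; exists g0.
have /choice[g_ Hg] (n : nat) : exists g, strong_gradient mu p u g /\
    (energy g < ereal_inf V + (n.+1%:R^-1)%:E)%E.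
  have n0 : 0 < n.+1%:R^-1 :> R by rewrite invr_gt0.
  have [_ [g sg <-] h] := lb_ereal_inf_adherent n0 mfin.
  by exists g.
pose h_ := running_min g_.
have sh n : strong_gradient mu p u (h_ n).
  elim: n => [|n IH]; first by have [] := Hg 0%N.
  by apply: strong_gradient_min => //; have [] := Hg n.+1.
have h_le n x : (h_ n x <= g_ n x)%E.
  by case: n => [|n] //=; rewrite ge_min lexx orbT.
have h_noninc x : {homo h_^~ x : n m / (n <= m)%N >-> (m <= n)%E}.
  move=> n m; elim: m => [|m IH]; first by rewrite leqn0 => /eqP ->.
  rewrite leq_eqVlt => /predU1P[->//|]; rewrite ltnS => /IH; apply: le_trans.
  by rewrite /= ge_min lexx.
pose h x := ereal_inf (range (h_^~ x)).
have hh x : h_ n x @[n --> \oo] --> h x := ereal_nonincreasing_cvgn (h_noninc x).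
have sh' : strong_gradient mu p u h.
  apply: (strong_gradient_lim p0 sh) => // n x.
  exact: (h_noninc x 0%N).
have [bh eh _] := sh'; have [hp mh] := bh.
have hle n x : (h x <= h_ n x)%E by apply: ereal_inf_lbound; exists n.
have ehm : energy h = ereal_inf V.
  apply/eqP; rewrite eq_le; apply/andP; split; last first.
    by apply: ereal_inf_lbound; exists h.
  apply/lee_addgt0Pr => e e0.
  have [n ne] : exists n : nat, (n.+1%:R^-1 <= e :> R).
    exists (Num.truncn e^-1); rewrite invf_ple ?posrE//.
    by apply/ltW; exact: truncnS_gt.
  have [sgn gn] := Hg n.
  apply: (@le_trans _ _ (energy (g_ n))).
    apply: p_energy_le => // [|x]; first exact: ltW.
    exact: le_trans (hle n x) (h_le n x).
  by apply: le_trans (ltW gn) _; rewrite leeD2l// lee_fin.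
exists h; split => //; split => //; first exact: strong_weak_gradient.
(* The minimum of [h] and a competitor is again a strong gradient, so it cannot have less energy
   than [h] and equals [h] almost everywhere. *)
move=> g' wg' eg'; have [k [sk gk]] := borel_majorant p0 eg' wg'.
have smin := strong_gradient_min p0 sh' sk.
have [bmin _ _] := smin.
have hk : {ae mu, forall x, Order.min (h x) (k x) = h x}.
  apply: p_energy_eq_ae => //.
    by move=> x; rewrite ge_min lexx.
  rewrite ehm; apply: ereal_inf_lbound.
  by exists (fun x => Order.min (h x) (k x)).
apply: (@filterS2 _ _ (ae_filter_ringOfSetsType mu) _ _ _ _ gk hk) => x /= -> <-.
by rewrite ge_min lexx orbT.
Qed.

End MinimalGradient.

(** * Local connectedness *)

Section CutoffGradient.
Context {R : realType}.
Implicit Types (F : R -> R) (s t a b L M : R).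

Definition interval_continuous L F := forall t e, 0 <= t <= L -> 0 < e ->
  exists2 d, 0 < d & forall s, 0 <= s <= L -> `|t - s| < d -> `|F t - F s| < e.

(** The time is the supremum of those with [F t <= a]; continuity shows that it is attained. *)
Lemma last_below F L a : 0 <= L -> interval_continuous L F -> F 0 <= a ->
  exists t, [/\ 0 <= t <= L, F t <= a & forall s, t < s <= L -> a < F s].
Proof.
move=> L0 cF Fa; pose S := [set t | 0 <= t <= L /\ F t <= a].
have S0 : S 0 by split => //; rewrite lexx.
have hS : has_sup S by split; [exists 0|exists L => t [/andP[]]].
have ubS t : S t -> t <= sup S by move=> St; apply: ub_le_sup => //; case: hS.
have s0L : 0 <= sup S <= L.
  by rewrite ubS//= ge_sup//; [exists 0|move=> t [/andP[]]].
exists (sup S); split => //.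
  rewrite leNgt; apply/negP => aF; have aF' : 0 < F (sup S) - a by rewrite subr_gt0.
  have [d d0 dF] := cF _ _ s0L aF'.
  have [t [tL Ft] st] := sup_adherent d0 hS.
  have tS : t <= sup S by apply: ubS.
  have := dF _ tL; rewrite ger0_norm ?subr_ge0// => /(_ _) h.
  have : `|F (sup S) - F t| < F (sup S) - a by apply: h; lra.
  by rewrite ltr_norml => /andP[_]; lra.
move=> s /andP[s1 s2]; rewrite ltNge; apply/negP => Fs.
have : s <= sup S by apply: ubS; split => //; rewrite s2 andbT; lra.
lra.
Qed.

(** The previous lemma for [- F] with time reversed. *)
Lemma first_above F L b : 0 <= L -> interval_continuous L F -> b <= F L ->
  exists t, [/\ 0 <= t <= L, b <= F t & forall s, 0 <= s < t -> F s < b].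
Proof.
move=> L0 cF bF.
have cG : interval_continuous L (fun t => - F (L - t)).
  move=> t e tL e0; have tL' : 0 <= L - t <= L by lra.
  have [d d0 dF] := cF _ _ tL' e0; exists d => // s sL ts.
  have h1 : 0 <= L - s <= L by lra.
  have h2 : `|L - t - (L - s)| < d.
    by rewrite (_ : _ - _ = s - t) 1?distrC//; ring.
  by rewrite -opprD normrN; exact: dF.
have [|t [tL Ft Ht]] := last_below (a := - b) L0 cG.
  by rewrite subr0 lerN2.
exists (L - t); split; [lra|by rewrite -lerN2|].
move=> s sL; have /Ht : t < L - s <= L by lra.
by rewrite ltrN2 opprB addrC subrK.
Qed.

(** From the last time at or below [a] to the first later time at or above [b]. *)
Lemma rising_interval F L a b : 0 <= L -> interval_continuous L F ->
  F 0 <= a -> a < b -> b <= F L -> exists s t, [/\ 0 <= s, s < t, t <= L,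
    F s <= a /\ b <= F t & forall r, s < r < t -> a < F r < b].
Proof.
move=> L0 cF Fa ab bF; have [s [/andP[s0 sL] Fs Hs]] := last_below L0 cF Fa.
have Ls0 : 0 <= L - s by lra.
have cG : interval_continuous (L - s) (fun t => F (s + t)).
  move=> t e tL e0; have tL' : 0 <= s + t <= L by lra.
  have [d d0 dF] := cF _ _ tL' e0; exists d => // r rL tr; apply: dF; first lra.
  by rewrite opprD addrACA subrr add0r.
have bF' : b <= F (s + (L - s)) by rewrite addrC subrK.
have [t [/andP[t0 tL] Ft Ht]] := first_above Ls0 cG bF'.
have t_gt0 : 0 < t.
  rewrite lt_neqAle t0 andbT; apply/eqP => t0'.
  by move: Ft; rewrite -t0' addr0; lra.
exists s, (s + t); split => //; [lra|lra|].
move=> r /andP[sr rt]; rewrite Hs; last lra.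
have /Ht : 0 <= r - s < t by lra.
by rewrite addrC subrK.
Qed.

End CutoffGradient.

Section CutoffUpperGradient.
Context {R : realType} {X : completeMetricType R}.
Implicit Types (u v : X -> R) (M : R) (A : set X).

Definition cst_on A M : X -> \bar R := fun y => if y \in A then M%:E else 0%E.

Lemma borel_cst_on A M : 0 <= M -> measurable (A : set (borel X)) ->
  borel_nonneg (cst_on A M).
Proof.
move=> M0 mA; split; first by move=> y; rewrite /cst_on; case: ifP.
apply: measurable_fun_ifT => //.
apply: (measurable_fun_bool true); rewrite setTI (_ : _ @^-1` _ = A)//.
by apply/seteqP; split=> t /=; [move=> /set_mem|move=> /mem_set].
Qed.

Lemma p_energy_cst_on (mu : {measure set (borel X) -> \bar R}) p A M :
  0 < p -> 0 <= M -> measurable (A : set (borel X)) ->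
  p_energy mu p (cst_on A M) = ((M `^ p)%:E * mu A)%E.
Proof.
move=> p0 M0 mA; rewrite -[in RHS](setTI A) -integral_cst//.
rewrite [RHS]integral_mkcondr; apply: eq_integral => y _.
rewrite patchE /cst_on; case: ifP => _; last by rewrite abse0 poweR0r// gt_eqF.
  by rewrite gee0_abs// poweR_EFin.
by rewrite setTI.
Qed.

Lemma curve_integral_cst_on A M (c : rect_curve X) s t : 0 <= M ->
  measurable (A : set (borel X)) -> 0 <= s -> s < t -> t <= arc_len c ->
  (forall r, s < r < t -> A (c r)) ->
  ((M * (t - s))%:E <= curve_integral (cst_on A M) c)%E.
Proof.
move=> M0 mA s0 st tL HA; have [g0 mg] := borel_cst_on M0 mA.
apply: (@le_trans _ _ (\int[lebesgue_measure]_(r in `]s, t[) cst_on A M (c r))%E).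
  rewrite [leRHS](_ : _ = \int[lebesgue_measure]_(r in `]s, t[) (cst M%:E) r)%E.
    rewrite integral_cst//= lebesgue_measure_itv /= lte_fin st.
    by rewrite -EFinB -EFinM.
  apply: eq_integral => r; rewrite inE /= in_itv /= => rst.
  by rewrite /cst_on mem_set//; exact: HA.
apply: ge0_subset_integral => //; first exact: measurable_curve.
move=> r /=; rewrite !in_itv /= => /andP[h1 h2]; apply/andP; split; lra.
Qed.

Lemma curve_interval_continuous u (c : rect_curve X) : continuous u ->
  interval_continuous (arc_len c) (fun t => u (c t)).
Proof.
move=> cu t e tL e0; have /cvgrPdist_lt/(_ e e0)/nbhs_ballP[d d0 du] := cu (c t).
exists d => // s sL ts; apply: du; rewrite in_ball; apply: le_lt_trans ts.
have [st|st] := leP s t.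
  rewrite metric_sym ger0_norm ?subr_ge0//; apply: curve_lip => //; lra.
rewrite ltr0_norm ?subr_lt0// opprB; apply: curve_lip; lra.
Qed.

(* Between the last time u is below its lower end value and the next time it
   reaches the upper one, 0 < u < 1 and u coincides with v. *)
Lemma cutoff_upper_gradient u v M : 0 < M -> continuous u ->
  (forall y, 0 <= u y <= 1) -> (forall y z, `|v y - v z| <= M * mdist y z) ->
  (forall y, 0 < u y -> u y = v y) ->
  upper_gradient (EFin \o u) (cst_on [set y | 0 < u y < 1] M).
Proof.
move=> M0 cu u01 lipv uv.
pose A := [set y | 0 < u y < 1].
have mA : measurable (A : set (borel X)).
  apply: open_measurable_borel.
  rewrite (_ : A = u @^-1` `]0, 1[%classic); last first.
    by apply/seteqP; split=> y /=; rewrite in_itv.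
  by apply: open_comp => [y _|]; [exact: cu|exact: itv_open].
split; first exact: borel_cst_on (ltW M0) mA.
move=> c; rewrite /upper_gradient_along /=.
have L0 := arc_len_gt0 c.
have cF := curve_interval_continuous cu (c := c).
have [L LE] : exists L, L = arc_len c by exists (arc_len c).
rewrite -LE in L0 cF *.
(* [u] and [v] need not agree at the end points, so these are moved inside by a small [d], at a cost
   [e] that tends to 0 by continuity of [u]. *)
have key s t : 0 <= s -> s < t -> t <= L -> (forall r, s < r < t -> A (c r)) ->
    `|u (c t) - u (c s)| <= M * (t - s).
  move=> s0 st tL HA; apply/ler_addgt0Pr => e e0.
  have e3 : 0 < e / 2 by lra.
  have sL' : 0 <= s <= L by lra.
  have tL' : 0 <= t <= L by lra.
  have [d1 d10 H1] := cF s (e / 2) sL' e3.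
  have [d2 d20 H2] := cF t (e / 2) tL' e3.
  pose d := Num.min ((t - s) / 3) (Num.min (d1 / 2) (d2 / 2)).
  have dd : 0 < d by rewrite !lt_min; apply/and3P; split; lra.
  have [dt dd1 dd2] : [/\ d <= (t - s) / 3, d <= d1 / 2 & d <= d2 / 2].
    by rewrite /d !ge_min !lexx !orbT.
  have /ltW h1 : `|u (c s) - u (c (s + d))| < e / 2.
    apply: H1; first lra.
    by rewrite opprD addNKr normrN gtr0_norm; lra.
  have /ltW h2 : `|u (c t) - u (c (t - d))| < e / 2.
    apply: H2; first lra.
    by rewrite opprB addrC subrK gtr0_norm; lra.
  have /andP[us _] : A (c (s + d)) by apply: HA; lra.
  have /andP[ut _] : A (c (t - d)) by apply: HA; lra.
  have h3 : `|u (c (t - d)) - u (c (s + d))| <= M * (t - s).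
    rewrite (uv _ us) (uv _ ut); apply: le_trans (lipv _ _) _.
    rewrite ler_pM2l// metric_sym; apply: (@le_trans _ _ ((t - d) - (s + d))).
      by apply: curve_lip; lra.
    lra.
  rewrite (_ : u (c t) - u (c s) = (u (c t) - u (c (t - d))) +
    (u (c (t - d)) - u (c (s + d))) - (u (c s) - u (c (s + d)))); last by ring.
  apply: le_trans (ler_normB _ _) _; have := ler_normD (u (c t) - u (c (t - d)))
    (u (c (t - d)) - u (c (s + d))); lra.
(* Used for [u] along rising curves and for [1 - u] along falling ones. *)
have rise (G : R -> R) : interval_continuous L G ->
    (forall r, 0 < G r < 1 -> A (c r)) -> (forall r, 0 <= G r <= 1) ->
    (forall s t, `|G t - G s| = `|u (c t) - u (c s)|) -> G 0 < G L ->
    ((`|G 0 - G L|)%:E <= curve_integral (cst_on A M) c)%E.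
  move=> cG GA G01 Gu G0L.
  have [s [t [s0 st tL [Fs Ft] H]]] := rising_interval (ltW L0) cG (lexx _) G0L (lexx _).
  have HA r : s < r < t -> A (c r).
    move=> /H /andP[h1 h2]; apply: GA; have := G01 0; have := G01 L; lra.
  have tL' : t <= arc_len c by rewrite -LE.
  apply: le_trans (curve_integral_cst_on (ltW M0) mA s0 st tL' HA).
  rewrite lee_fin; apply: le_trans (key _ _ s0 st tL HA); rewrite -Gu.
  by rewrite distrC !ger0_norm; lra.
have [h|h|->] := ltgtP (u (c 0)) (u (c L)).
- exact: (rise (fun t => u (c t))).
- rewrite (_ : _ - _ = - ((1 - u (c 0)) - (1 - u (c L)))); last by ring.
  rewrite normrN; apply: (rise (fun t => 1 - u (c t))).
  + move=> t e tL e0; have [d d0 H] := cF t e tL e0; exists d => // s sL ts.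
    by rewrite (_ : _ - _ = - (u (c t) - u (c s))); [rewrite normrN H|ring].
  + by move=> r h'; rewrite /A /=; lra.
  + by move=> r; have := u01 (c r); lra.
  + by move=> s t; rewrite distrC; congr `|_|; ring.
  + lra.
- rewrite subrr normr0; apply: curve_integral_ge0 => y.
  by have [] := borel_cst_on (ltW M0) mA.
Qed.

End CutoffUpperGradient.

(** * Connectedness from the Poincare inequality *)

Section PoincareConnectivity.
Context {R : realType} {X : completeMetricType R}.
Variables (mu : {measure set (borel X) -> \bar R}) (p : R).
Implicit Types (x y z : X) (A B K U V : set X) (r e : R).

(** A nonempty open set contains a ball, which has positive measure and is not negligible. *)
Lemma ae_open_exists U (P : X -> Prop) : balls_pos_finite mu -> open U -> U !=set0 ->
  mu.-negligible [set y : borel X | U y /\ ~ P y] -> exists2 y, U y & P y.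
Proof.
move=> mub oU [y Uy] neg; apply: contrapT => nE.
have [r r0 rU] := (openE_ball U).1 oU y Uy.
have [N [mN N0 UN]] := neg.
have /andP[] := mub y r r0; rewrite ltNge => /negP + _; apply.
rewrite -N0; apply: le_measure; rewrite ?inE//.
  exact: measurable_ball_borel.
by move=> z /rU Uz; apply: UN; split => // Pz; apply: nE; exists z.
Qed.

(** Equal to 1 up to [r / 2], to 0 from [3 / 4 * r] on, and affine of slope [- 4 / r] between.
    Vanishing before [r] makes the cutoff continuous across the sphere of radius [r]. *)
Definition ramp r (s : R) : R := Num.max 0 (Num.min 1 (3 - 4 * s / r)).

Lemma ramp01 r s : 0 <= ramp r s <= 1.
Proof.
by rewrite /ramp le_max lexx /= ge_max ler01 /= ge_min lexx.
Qed.

Lemma ramp_lip r s t : 0 < r -> `|ramp r s - ramp r t| <= 4 / r * `|s - t|.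
Proof.
move=> r0.
have clip (a b : R) : `|Num.max 0 (Num.min 1 a) - Num.max 0 (Num.min 1 b)| <= `|a - b|.
  rewrite ler_norml; have := ler_norm (a - b); have := ler_norm (b - a).
  rewrite (distrC b a) /Order.max /Order.min; do 4 case: ifP; lra.
apply: le_trans (clip _ _) _.
rewrite (_ : _ - _ = - ((4 / r) * (s - t))); last by field; rewrite gt_eqF.
by rewrite normrN normrM ger0_norm// divr_ge0// ltW.
Qed.

Lemma ramp_le_half r s : 0 < r -> s <= r / 2 -> ramp r s = 1.
Proof.
move=> r0 sr; have h : 1 <= 3 - 4 * s / r.
  have : 4 * s / r <= 2 by rewrite ler_pdivrMr//; lra.
  lra.
by rewrite /ramp min_l// max_r.
Qed.

Lemma ramp_ge r s : 0 < r -> 3 / 4 * r <= s -> ramp r s = 0.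
Proof.
move=> r0 sr; have h : 3 - 4 * s / r <= 0.
  have : 3 <= 4 * s / r by rewrite ler_pdivlMr//; lra.
  lra.
by rewrite /ramp max_l// ge_min h orbT.
Qed.

Definition cutoff A x r y : R := if y \in A then ramp r (mdist x y) else 0.

(** Near a point, the cutoff is either identically zero (outside the ball, or inside it off [A]) or
    equal to the ramp. *)
Lemma cutoff_continuous A x r : 0 < r ->
  open (A `&` ball x r) -> open (ball x r `\` A) -> continuous (cutoff A x r).
Proof.
move=> r0 oA oB y.
have cv : continuous (fun y => ramp r (mdist x y)).
  move=> z; apply/cvgrPdist_lt => e e0; near=> w.
  apply: le_lt_trans (ramp_lip _ _ r0) _.
  have M0 : 0 < 4 / r by rewrite divr_gt0.
  rewrite -ltr_pdivlMl//; apply: le_lt_trans (mdist_lip _ _ _) _.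
  rewrite -in_ball; near: w; apply: nbhsx_ballx.
  by rewrite mulr_gt0// invr_gt0 divr_gt0.
have far z : 3 / 4 * r <= mdist x z -> cutoff A x r z = 0.
  by move=> h; rewrite /cutoff ramp_ge// if_same.
have const0 V : open V -> V y -> (forall z, V z -> cutoff A x r z = 0) ->
    {for y, continuous (cutoff A x r)}.
  move=> oV Vy V0; rewrite /prop_for /continuous_at (V0 _ Vy).
  apply: cvg_near_cst; apply: filterS (open_nbhs_nbhs (conj oV Vy)) => z; exact: V0.
have [xy|xy] := ltP (mdist x y) r; last first.
  apply: (const0 [set z | 3 / 4 * r < mdist x z]).
  - rewrite (_ : [set _ | _] = mdist x @^-1` [set t | 3 / 4 * r < t])//.
    by apply: open_comp; [move=> z _; exact: continuous_mdist|exact: open_gt].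
  - rewrite /=; lra.
  - by move=> z /ltW; exact: far.
have [Ay|nAy] := pselect (A y).
  have Vy : (A `&` ball x r) y by split => //; rewrite in_ball.
  have e z : (A `&` ball x r) z -> cutoff A x r z = ramp r (mdist x z).
    by move=> [Az _]; rewrite /cutoff mem_set.
  rewrite /prop_for /continuous_at (e _ Vy).
  apply: cvg_trans (cv y); apply: near_eq_cvg.
  by apply: filterS (open_nbhs_nbhs (conj oA Vy)) => z /e ->.
apply: (const0 (ball x r `\` A)) => //; first by split => //; rewrite in_ball.
by move=> z [_ nAz]; rewrite /cutoff memNset.
Unshelve. all: by end_near. Qed.

Lemma cutoff01 A x r y : 0 <= cutoff A x r y <= 1.
Proof. by rewrite /cutoff; case: ifP => _; rewrite ?ramp01// lexx ler01. Qed.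

Lemma upper_weak_gradient u g : 0 < p -> upper_gradient u g ->
  weak_upper_gradient mu p u g.
Proof.
move=> p0 [[g0 mg] H]; split => //.
  exact: borel_mu_measurable.
exists set0 => //; exists (cst 0%E); split => //.
rewrite p_energyE// integral0_eq// => y _.
by rewrite poweR0r// gt_eqF.
Qed.

(* The cutoff of the indicator of a relatively clopen A has zero gradient on the
   half ball, so the Poincare inequality makes it constant there. *)
Lemma poincare_clopen : 1 <= p -> balls_pos_finite mu -> poincare mu p ->
  exists2 k, 0 < k & forall x r A, 0 < r ->
    open (A `&` ball x r) -> open (ball x r `\` A) -> A x ->
    ball x (r * k) `<=` A.
Proof.
move=> p1 mub [C [lam [C0 lam1 PI]]].
have p0 : 0 < p by lra.
have lam0 : 0 < lam by lra.
(* For a ball of radius [r / (2 * lam)], the enlarged ball in the Poincare inequality is the half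
   ball. *)
exists (2 * lam)^-1; first by rewrite invr_gt0 mulr_gt0.
move=> x r A r0 oA oB Ax.
pose u := cutoff A x r; pose M := 4 / r; have M0 : 0 < M by rewrite divr_gt0.
have cu : continuous u by exact: cutoff_continuous.
have u01 y : 0 <= u y <= 1 by exact: cutoff01.
pose D := [set y | 0 < u y < 1].
have u_far y : r <= mdist x y -> u y = 0.
  by move=> h; rewrite /u /cutoff ramp_ge ?if_same//; lra.
have ug : upper_gradient (EFin \o u) (cst_on D M).
  apply: (@cutoff_upper_gradient _ _ u (fun y => ramp r (mdist x y))) => //.
    move=> y z; apply: le_trans (ramp_lip _ _ r0) _.
    by rewrite ler_pM2l ?divr_gt0// mdist_lip.
  by move=> y; rewrite /u /cutoff; case: ifP => //; rewrite ltxx.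
have mD : measurable (D : set (borel X)).
  apply: open_measurable_borel; rewrite (_ : D = u @^-1` `]0, 1[%classic).
    by apply: open_comp => [y _|]; [exact: cu|exact: itv_open].
  by apply/seteqP; split=> y /=; rewrite in_itv.
have mball s : measurable (ball x s : set (borel X)) by exact: measurable_ball_borel.
have muball : (mu (ball x r) < +oo)%E by have /andP[] := mub x r r0.
have Dball : D `<=` ball x r.
  move=> y /andP[uy _]; rewrite in_ball ltNge; apply/negP => /u_far h.
  by move: uy; rewrite h ltxx.
have eD : (p_energy mu p (cst_on D M) < +oo)%E.
  rewrite p_energy_cst_on//; last exact: ltW.
  have muD : mu D \is a fin_num.
    rewrite ge0_fin_numE//; apply: le_lt_trans muball.
    by apply: le_measure; rewrite ?inE.
  by rewrite -(fineK muD) -EFinM ltry.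
have mu_u : measurable_fun setT (u : borel X -> R).
  apply: (measurability (@RGenOInfty.G R)); first exact: RGenOInfty.measurableE.
  move=> _ [_ [a ->] <-]; rewrite setTI; apply: open_measurable_borel.
  apply: open_comp => [y _|]; first exact: cu.
  rewrite (_ : `]a, +oo[%classic = [set t | a < t]); first exact: open_gt.
  by apply/seteqP; split=> t /=; rewrite in_itv /= andbT.
have mEu : measurable_fun setT (EFin \o u : borel X -> \bar R).
  exact/measurable_EFinP.
have nu : newtonian mu p (EFin \o u).
  split.
    exact: borel_mu_measurable.
  apply: lte_add_pinfty; last first.
    by apply: le_lt_trans eD; apply: ereal_inf_lbound; exists (cst_on D M).
  apply: (@le_lt_trans _ _ (p_energy mu p (cst_on (ball x r) 1))).
    apply: p_energy_le => [|y|y] /=; first exact: ltW.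
      by rewrite lee_fin; have /andP[] := u01 y.
    rewrite /cst_on; case: ifPn; first by rewrite lee_fin; have /andP[] := u01 y.
    by rewrite notin_setE in_ball => /negP; rewrite -leNgt => /u_far ->.
  by rewrite p_energy_cst_on// powR1 mul1e.
have [g [sg mg]] := minimal_gradient_exists p0
  (weak_strong_gradient p0 (borel_cst_on (ltW M0) mD) eD (upper_weak_gradient p0 ug)).
have [[g0 mbg] _ _] := sg.
have gD : {ae mu, forall y, (g y <= cst_on D M y)%E}.
  by have [_ _] := mg; apply => //; exact: upper_weak_gradient.
pose s := r * (2 * lam)^-1.
have s0 : 0 < s by rewrite mulr_gt0 ?invr_gt0 ?mulr_gt0.
have lams : lam * s = r / 2.
  by rewrite /s; field; rewrite gt_eqF.
have sr : s <= r / 2.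
  by rewrite -lams ler_peMl// ltW.
have u1 y : mdist x y <= r / 2 -> A y -> u y = 1.
  by move=> h Ay; rewrite /u /cutoff mem_set// ramp_le_half.
have u0 y : ~ A y -> u y = 0 by move=> nA; rewrite /u /cutoff memNset.
(* On the half ball [u] takes only the values 0 and 1, so the gradient, bounded by a function living
   on [D], vanishes almost everywhere there. *)
have int0 : (\int[mu]_(y in ball x (r / 2)) (g y `^ p) = 0)%E.
  have p_ne0 : p != 0 by rewrite gt_eqF.
  rewrite (ae_eq_integral (cst 0%E)) ?integral0//.
    exact: measurable_funTS (measurable_poweR_comp p mbg).
  apply: (@filterS _ _ (ae_filter_ringOfSetsType mu) _ _ _ gD) => y /= gy.
  rewrite in_ball => xy.
  have nD : ~ D y.
    have [Ay|nA] := pselect (A y); first by rewrite /D /= (u1 _ (ltW xy) Ay) ltxx andbF.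
    by rewrite /D /= (u0 _ nA) ltxx.
  move: gy; rewrite /cst_on memNset// => gy.
  have -> : g y = 0%E by apply/eqP; rewrite eq_le gy g0.
  by rewrite poweR0r.
have := PI x s (EFin \o u) g s0 nu mg; rewrite /= lams.
have rhs0 : average mu (ball x (r / 2)) (fun y => (g y `^ p)%E) = 0%E.
  by rewrite /average int0 mule0.
rewrite rhs0 poweR0r ?invr_eq0 ?gt_eqF// mule0.
set a := average mu (ball x s) (EFin \o u) => le0.
have /andP[muB0 muBy] := mub x s s0.
have fB : 0 < (fine (mu (ball x s)))^-1.
  by rewrite invr_gt0 fine_gt0// muB0.
have md : @measurable_fun _ _ (borel X) (\bar R) (ball x s)
    (fun y => (u y)%:E - a)%E.
  by apply: emeasurable_funB; [exact: measurable_funTS|exact: measurable_cst].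
have I0 : (\int[mu]_(y in ball x s) `|(u y)%:E - a| = 0)%E.
  apply/eqP; rewrite eq_le; apply/andP; split; last exact: integral_ge0.
  rewrite leNgt; apply/negP => h; move: le0; rewrite leNgt => /negP; apply.
  by apply: mule_gt0 => //; rewrite lte_fin.
have ae0 := (ae_eq_integral_abs mu (mball s) md).1 I0.
(* [u] equals its average [a] almost everywhere on the small ball, hence at some point of each
   nonempty open part. Inside [A] this forces [a] to be 1; a point off [A] would force 0. *)
have pick V : open V -> V `<=` ball x s -> V !=set0 ->
    exists2 y, V y & ((u y)%:E - a = 0)%E.
  move=> oV Vs V0; apply: ae_open_exists => //.
  by apply: negligibleS ae0 => y /= [Vy ny] h; apply: ny; apply: h; exact: Vs.
have ballsr : ball x s `<=` ball x r.
  by apply: le_ball; lra.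
have a1 : a = 1%E.
  have [|||y [[Ay _] ys]] := pick (A `&` ball x r `&` ball x s).
  - by apply: openI => //; exact: ball_open_metric.
  - exact: subIsetr.
  - by exists x; split; [split|] => //; exact: ballxx.
  rewrite u1//; last first.
    by move: ys; rewrite in_ball => /ltW /le_trans; apply.
  by case: a {le0 md I0 ae0 pick} => //= t [] h; congr EFin; lra.
move=> z zs; apply: contrapT => nA.
have [|||y [[_ nAy] _]] := pick ((ball x r `\` A) `&` ball x s).
- by apply: openI => //; exact: ball_open_metric.
- exact: subIsetr.
- by exists z; split => //; split => //; exact: ballsr.
by rewrite (u0 _ nAy) a1 => -[] h; lra.
Qed.

(** Doubled balls around points of [A] must miss [B]; this leaves room to make the neighbourhoods of
    [A] and [B] disjoint. *)
Definition separating_nbhd A B := [set w : X | exists y r,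
  [/\ A y, 0 < r, ball y (2 * r) `&` B = set0 & ball y r w]].

Lemma separating_nbhd_open A B : open (separating_nbhd A B).
Proof.
apply/openE_ball => w [y [r [Ay r0 yB yw]]].
have [d d0 dr] := (openE_ball (ball y r)).1 (ball_open_metric y r) w yw.
by exists d => // z /dr yz; exists y, r.
Qed.

Lemma sub_separating_nbhd A B : closed B -> A `&` B = set0 ->
  A `<=` separating_nbhd A B.
Proof.
move=> cB AB y Ay; have nB : (~` B) y.
  by move=> By; have : (A `&` B) y by []; rewrite AB.
have [r r0 rB] := (openE_ball (~` B)).1 (closed_openC cB) y nB.
have r2 : 0 < r / 2 by rewrite divr_gt0.
exists y, (r / 2); split => //; last exact: ballxx.
rewrite mulrC divfK//; apply/seteqP; split=> // z [yz Bz]; exact: rB yz Bz.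
Qed.

(** At a common point, doubling the larger of the two balls would capture the centre of the other
    one. *)
Lemma separating_nbhd_disjoint A B :
  separating_nbhd A B `&` separating_nbhd B A = set0.
Proof.
apply/seteqP; split=> // w [[y [r [Ay r0 yB]]] + [z [t [Bz t0 zA]]]].
rewrite !in_ball => yw zw; have := metric_triangle y w z.
rewrite (metric_sym w z) => yz.
have [rt|tr] := leP t r.
  have : (ball y (2 * r) `&` B) z by split => //; rewrite in_ball; lra.
  by rewrite yB.
have : (ball z (2 * t) `&` A) y by split => //; rewrite in_ball metric_sym; lra.
by rewrite zA.
Qed.

Definition relative_clopens K x :=
  [set A | [/\ A `<=` K, closed A, closed (K `\` A) & A x]].

(** Were [Q] split into closed parts [B1], containing [x], and [B2], a clopen subset of [K]
    containing [x] but missing [B2] would exist, so [B2] is empty. *)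
Lemma quasicomponent_connected K x : compact K -> closed K -> K x ->
  connected (\bigcap_(A in relative_clopens K x) A).
Proof.
move=> coK cK Kx; set Q := \bigcap_(A in _) A.
have cQ : closed Q by apply: closed_bigI => A [].
have Qx : Q x by move=> A [].
have PI A B : relative_clopens K x A -> relative_clopens K x B ->
    relative_clopens K x (A `&` B).
  move=> [AK cA cKA Ax] [BK cB cKB Bx]; split.
  - by move=> y [/AK].
  - exact: closedI.
  - by rewrite setDIr; exact: closedU.
  - by [].
have PK : relative_clopens K x K.
  by split => //; rewrite setDv; exact: closed0.
have half B1 B2 : closed B1 -> closed B2 -> B1 `&` B2 = set0 -> Q = B1 `|` B2 ->
    B1 x -> B2 = set0.
  move=> c1 c2 B12 QB B1x.
  pose V1 := separating_nbhd B1 B2; pose V2 := separating_nbhd B2 B1.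
  have V12 y : V1 y -> V2 y -> False.
    by move=> h1 h2; have : (V1 `&` V2) y by []; rewrite separating_nbhd_disjoint.
  have sub1 : B1 `<=` V1 by exact: sub_separating_nbhd.
  have sub2 : B2 `<=` V2 by apply: sub_separating_nbhd => //; rewrite setIC.
  have oV1 : open V1 by exact: separating_nbhd_open.
  have oV2 : open V2 by exact: separating_nbhd_open.
  have cV : closed (~` (V1 `|` V2)) by exact/open_closedC/openU.
  (* By compactness: otherwise the parts of the clopen sets outside [V1] and [V2] have a common
     point, which is in [Q] but not in [B1] or [B2]. *)
  have [A PA AV] : exists2 A, relative_clopens K x A & A `<=` V1 `|` V2.
    apply: contrapT => nA; pose F A := A `\` (V1 `|` V2).
    have FF : ProperFilter (filter_from (relative_clopens K x) F).
      apply: filter_from_proper.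
        apply: filter_from_filter; first by exists K.
        move=> A B PA PB; exists (A `&` B); first exact: PI.
        by move=> y [[Ay By] nV].
      move=> A PA; apply: contrapT => nF; apply: nA; exists A => // y Ay.
      by apply: contrapT => nV; apply: nF; exists y.
    have [|q [_ clq]] := coK _ FF; first by exists K => // y [].
    have FAq A : relative_clopens K x A -> F A q.
      move=> PA; have [_ cA _ _] := PA; have cFA : closed (F A) by exact: closedI.
      by apply: cFA => U Uq; apply: clq => //; exists A.
    have Qq : Q q by move=> A /FAq[].
    have [_] := FAq _ PK; apply.
    by move: Qq; rewrite QB => -[/sub1|/sub2]; [left|right].
  have [AK cA cKA Ax] := PA.
  (* Since [A] is covered by the disjoint open sets [V1] and [V2], removing [V2] leaves a relatively
     clopen set. *)
  have PA' : relative_clopens K x (A `\` V2).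
    split.
    - by move=> y [/AK].
    - by apply: closedI => //; exact: open_closedC.
    - rewrite (_ : _ `\` _ = (K `\` A) `|` (A `\` V1)).
        by apply: closedU => //; apply: closedI => //; exact: open_closedC.
      apply/seteqP; split=> y.
        move=> [Ky nAV]; have [Ay|nAy] := pselect (A y); last by left.
        right; split => // V1y; apply: nAV; split => //; exact: V12.
      move=> [[Ky nAy]|[Ay nV1]]; first by split => // -[].
      by split; [exact: AK|move=> [_ nV2]; have [] := AV y Ay].
    - by split => // /(V12 _ (sub1 _ B1x)).
  apply/seteqP; split=> // y B2y.
  have Qy : Q y by rewrite QB; right.
  by have [_] := Qy _ PA'; apply; exact: sub2.
move=> B B0 [C oC BC] [D cD BD].
have cB : closed B by rewrite BD; exact: closedI.
have cB' : closed (Q `\` B).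
  rewrite (_ : _ `\` _ = Q `&` ~` C); first by apply: closedI => //; exact: open_closedC.
  by rewrite BC setDIr setDv set0U.
have BQ : B `<=` Q by rewrite BC; exact: subIsetl.
have [Bx|nBx] := pselect (B x).
  have : Q `\` B = set0.
    by apply: (half B) => //; [rewrite setDIK|rewrite setDUK].
  move=> QB; apply/seteqP; split => // y Qy; apply: contrapT => nBy.
  by have : (Q `\` B) y by []; rewrite QB.
have B_0 : B = set0.
  apply: (half (Q `\` B) B cB' cB); last by split.
    by rewrite setDKI.
  by rewrite setUC setDUK.
by move: B0; rewrite B_0 => -[].
Qed.

(** Every relatively clopen part of a closed ball containing the centre contains one fixed smaller
    ball; so does their intersection, the quasicomponent, which is connected. *)
Lemma poincare_locally_connected : 1 <= p -> balls_pos_finite mu -> doubling mu ->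
  poincare mu p -> forall U y, open U -> U y -> nbhs y (connected_component U y).
Proof.
move=> p1 mub mud mup U y oU Uy.
have [k k0 clo] := poincare_clopen p1 mub mup.
have [r r0 rU] := (openE_ball U).1 oU y Uy.
pose K := [set z | mdist y z <= r / 2].
have r20 : 0 < r / 2 by rewrite divr_gt0.
have Ky : K y by rewrite /K /= mdistxx ltW.
have cK : closed K by exact: cball_closed.
have coQ := quasicomponent_connected (cball_compact mub mud (x := y) (r := r / 2)) cK Ky.
set Q := bigcap _ _ in coQ.
have QK : Q `<=` K.
  by move=> z; apply; split => //; rewrite setDv; exact: closed0.
have QU : Q `<=` U.
  by move=> z /QK zK; apply: rU; rewrite in_ball; apply: le_lt_trans zK _; lra.
have bQ : ball y (r / 2 * k) `<=` Q.
  move=> z zb A [AK cA cKA Ay]; apply: (clo y (r / 2) A) zb => //.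
    rewrite (_ : _ `&` _ = ball y (r / 2) `&` ~` (K `\` A)).
      by apply: openI; [exact: ball_open_metric|exact: closed_openC].
    apply/seteqP; split=> w.
      by move=> [Aw wb]; split => // -[].
    move=> [wb nKA]; split => //; apply: contrapT => nAw; apply: nKA; split => //.
    by move: wb; rewrite in_ball => /ltW.
  by apply: openI; [exact: ball_open_metric|exact: closed_openC].
apply: (filterS (P := ball y (r / 2 * k))).
  move=> z /bQ; apply: connected_component_max => //.
  by move=> A [].
by apply: nbhsx_ballx; rewrite mulr_gt0.
Qed.

End PoincareConnectivity.

(** * Modulus of curves leaving a point *)

Section PointModulus.
Context {R : realType} {X : completeMetricType R}.
Variables (mu : {measure set (borel X) -> \bar R}) (p : R) (x : X).
Implicit Types (a b w r e : R) (c : rect_curve X).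

Definition annulus a b := [set y | a < mdist x y < b].

Lemma measurable_annulus a b : measurable (annulus a b : set (borel X)).
Proof.
apply: open_measurable_borel.
rewrite (_ : annulus a b = mdist x @^-1` `]a, b[%classic); last first.
  by apply/seteqP; split=> y /=; rewrite in_itv.
by apply: open_comp => [y _|]; [exact: continuous_mdist|exact: itv_open].
Qed.

(** Crossing the annulus takes a parameter interval of length at least [b - a], as an arc length
    parameterization is 1-Lipschitz. *)
Lemma annulus_integral a b w c : 0 <= w -> mdist x (c 0) <= a -> a < b ->
  b <= mdist x (c (arc_len c)) ->
  ((w * (b - a))%:E <= curve_integral (cst_on (annulus a b) w) c)%E.
Proof.
move=> w0 ca ab bc.
have cF := @curve_interval_continuous _ _ (mdist x) c (@continuous_mdist _ _ x).
have [s [t [s0 st tL [Fs Ft] H]]] := rising_interval (ltW (arc_len_gt0 c)) cF ca ab bc.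
apply: le_trans (curve_integral_cst_on w0 (measurable_annulus a b) s0 st tL H).
rewrite lee_fin ler_wpM2l//; have := curve_lip s0 (ltW st) tL.
have := metric_triangle x (c s) (c t); lra.
Qed.

Definition radius r j : R := r / 2 ^+ j.

Lemma radius_gt0 r j : 0 < r -> 0 < radius r j.
Proof. by move=> r0; rewrite divr_gt0// exprn_gt0. Qed.

Lemma radiusS r j : radius r j.+1 = radius r j / 2.
Proof. by rewrite /radius exprS invfM mulrCA mulrC. Qed.

Lemma radius_le r i j : 0 < r -> (i <= j)%N -> radius r j <= radius r i.
Proof.
move=> r0; elim: j => [|j IH]; first by rewrite leqn0 => /eqP ->.
rewrite leq_eqVlt => /predU1P[->//|]; rewrite ltnS => /IH; apply: le_trans.
by rewrite radiusS; have := radius_gt0 j r0; lra.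
Qed.

Lemma radius_le0 r j : 0 < r -> radius r j <= r.
Proof.
move=> r0; rewrite (le_trans (radius_le r0 (leq0n j)))//.
by rewrite /radius expr0 divr1.
Qed.

(* Each of the N dyadic annuli contributes 1/N to the integral along a curve
   that crosses all of them. *)
Fixpoint dyadic_density r N n : X -> \bar R :=
  if n is n'.+1 then fun y => (dyadic_density r N n' y +
    cst_on (annulus (radius r n) (radius r n')) (2 / (N%:R * radius r n')) y)%E
  else cst 0%E.

Lemma dyadic_weight_ge0 r N n : 0 < r -> 0 <= 2 / (N%:R * radius r n).
Proof. by move=> r0; rewrite divr_ge0// mulr_ge0// ltW// radius_gt0. Qed.

Lemma borel_dyadic_density r N n : 0 < r -> borel_nonneg (dyadic_density r N n).
Proof.
move=> r0; elim: n => [|n [IH0 IHm]] /=.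
  by split => //; exact: measurable_cst.
have [h0 hm] := borel_cst_on (dyadic_weight_ge0 N n r0)
  (measurable_annulus (radius r n.+1) (radius r n)).
by split=> [y|]; [exact: adde_ge0|exact: emeasurable_funD].
Qed.

Lemma dyadic_density_inside r N n y : 0 < r -> mdist x y < radius r n ->
  dyadic_density r N n y = 0%E.
Proof.
move=> r0; elim: n => [//|n IH] /= yn.
rewrite IH ?add0e; last by apply: lt_le_trans yn _; exact: radius_le.
rewrite /cst_on memNset//= => /andP[h _].
by move: (lt_trans yn h); rewrite ltxx.
Qed.

(** The annuli are disjoint, so at most one term is nonzero at each point and the energies add
    up. *)
Lemma dyadic_density_energy r N n (D : R) : 0 < p -> 0 < r ->
  (forall j, ((2 / (N%:R * radius r j)) `^ p)%:E *
    mu (annulus (radius r j.+1) (radius r j)) <= D%:E)%E ->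
  (p_energy mu p (dyadic_density r N n) <= (n%:R * D)%:E)%E.
Proof.
move=> p0 r0 HD; have p_ne0 : p != 0 by rewrite gt_eqF.
elim: n => [|n IH].
  rewrite mul0r p_energyE// integral0_eq// => y _; exact: poweR0r.
have [f0 mf] := borel_dyadic_density N n r0.
have mA := measurable_annulus (radius r n.+1) (radius r n).
have w0 := dyadic_weight_ge0 N n r0.
have [h0 hm] := borel_cst_on w0 mA.
set g := cst_on _ _ in h0 hm.
have -> : p_energy mu p (dyadic_density r N n.+1) =
    (p_energy mu p (dyadic_density r N n) + p_energy mu p g)%E.
  rewrite !p_energyE//; last by have [] := borel_dyadic_density N n.+1 r0.
  rewrite -ge0_integralD//; last 4 first.
  - by move=> y _; exact: poweR_ge0.
  - exact: measurable_poweR_comp.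
  - by move=> y _; exact: poweR_ge0.
  - exact: measurable_poweR_comp.
  apply: eq_integral => y _; rewrite /= -/g.
  have [/andP[_ yA]|nA] := pselect (annulus (radius r n.+1) (radius r n) y).
    by rewrite dyadic_density_inside// poweR0r// !add0e.
  by rewrite /g /cst_on memNset// adde0 poweR0r// adde0.
rewrite -natr1 mulrDl mul1r EFinD; apply: leeD => //.
by rewrite p_energy_cst_on.
Qed.

(** The annulus below [radius r n] has width [radius r n / 2], which its weight turns into 1/N. *)
Lemma dyadic_density_integral r N n c : 0 < r -> (0 < N)%N ->
  mdist x (c 0) <= radius r n -> r <= mdist x (c (arc_len c)) ->
  ((n%:R / N%:R)%:E <= curve_integral (dyadic_density r N n) c)%E.
Proof.
move=> r0 N0 cn cr; elim: n cn => [_|n IH cn].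
  by rewrite mul0r; apply: curve_integral_ge0.
have [f0 mf] := borel_dyadic_density N n r0.
have w0 := dyadic_weight_ge0 N n r0.
have [h0 hm] := borel_cst_on w0 (measurable_annulus (radius r n.+1) (radius r n)).
rewrite /curve_integral /= ge0_integralD//; last 2 first.
- exact: measurable_curve.
- exact: measurable_curve.
rewrite -natr1 mulrDl EFinD; apply: leeD.
  by apply: IH; apply: le_trans cn _; exact: radius_le.
have rn0 := radius_gt0 n r0.
apply: le_trans (annulus_integral w0 cn _ _); last 2 first.
- by rewrite radiusS; lra.
- by apply: le_trans cr; exact: radius_le0.
rewrite lee_fin radiusS le_eqVlt; apply/orP; left; apply/eqP.
by field; rewrite gt_eqF// pnatr_eq0 -lt0n.
Qed.

Hypothesis mu_balls : balls_pos_finite mu.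

(** The defining inequality with the larger radius frozen at [R0]. *)
Lemma dimension_growth q : pointwise_dimension_set mu x q -> exists C R0 : R,
  [/\ 0 < C, 0 < R0 & forall r, 0 < r -> r <= R0 ->
    (mu (ball x r) <= (C * r `^ q)%:E)%E].
Proof.
move=> [q0 [C [R0 [C0 R00 H]]]].
have fin r : 0 < r -> mu (ball x r) \is a fin_num /\ 0 < fine (mu (ball x r)).
  move=> r0; have /andP[m0 my] := mu_balls x r0.
  by rewrite ge0_fin_numE// fine_gt0// m0.
have [finR posR] := fin _ R00.
exists (C * fine (mu (ball x R0)) * R0^-1 `^ q), R0; split => //.
  by rewrite !mulr_gt0// powR_gt0// invr_gt0.
move=> r r0 rR; have [finr _] := fin _ r0.
rewrite -(fineK finr) lee_fin; have := H r R0 r0 rR (lexx _).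
rewrite ler_pdivrMr// => /le_trans; apply.
rewrite powRM ?invr_ge0 ?(ltW r0) ?(ltW R00)// le_eqVlt; apply/orP; left.
by apply/eqP; ring.
Qed.

(** The set is closed under decreasing the exponent, as [r / s <= 1]; containing 1 and nothing
    larger, it would be ]0, 1]. *)
Lemma dimension_set_gt1 : pointwise_dimension_set mu x 1 ->
  pointwise_dimension_set mu x <> `]0, 1]%classic ->
  exists2 q, 1 < q & pointwise_dimension_set mu x q.
Proof.
move=> Q1 QN; apply: contrapT => nq; apply: QN; apply/seteqP; split=> q /=.
  move=> Qq; rewrite in_itv /=; have [q0 _] := Qq; rewrite q0 /= leNgt.
  by apply/negP => q1; apply: nq; exists q.
rewrite in_itv /= => /andP[q0 q1]; split => //.
have [_ [C [R0 [C0 R00 H]]]] := Q1; exists C, R0; split => // r s r0 rs sR.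
have s0 : 0 < s by exact: lt_le_trans rs.
apply: le_trans (H r s r0 rs sR) _; rewrite ler_pM2l//.
by apply: ger_powR => //; rewrite divr_gt0//= ler_pdivrMr// mul1r.
Qed.

Lemma modulus_le_density (G : set (rect_curve X)) r N (D e : R) : 0 < p -> 0 < r ->
  (0 < N)%N ->
  (forall j, ((2 / (N%:R * radius r j)) `^ p)%:E *
    mu (annulus (radius r j.+1) (radius r j)) <= D%:E)%E -> N%:R * D <= e ->
  (forall c, G c -> mdist x (c 0) <= radius r N /\ r <= mdist x (c (arc_len c))) ->
  (modulus mu p G <= e%:E)%E.
Proof.
move=> p0 r0 N0 HD De HG.
apply: (@le_trans _ _ (p_energy mu p (dyadic_density r N N))).
  apply: ereal_inf_lbound; exists (dyadic_density r N N) => //.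
  split; first exact: borel_dyadic_density.
  move=> c /HG[c0 cL]; have := dyadic_density_integral r0 N0 c0 cL.
  by rewrite divff// pnatr_eq0 -lt0n.
by apply: le_trans (dyadic_density_energy N p0 r0 HD) _; rewrite lee_fin.
Qed.

Lemma annulus_measure_le C q R0 r N j : 0 < r -> r <= R0 ->
  (forall r, 0 < r -> r <= R0 -> (mu (ball x r) <= (C * r `^ q)%:E)%E) ->
  (((2 / (N%:R * radius r j)) `^ p)%:E * mu (annulus (radius r j.+1) (radius r j)) <=
   ((2 / (N%:R * radius r j)) `^ p * (C * radius r j `^ q))%:E)%E.
Proof.
move=> r0 rR HC; rewrite EFinM lee_wpmul2l// ?lee_fin ?powR_ge0//.
apply: le_trans (HC _ (radius_gt0 j r0) (le_trans (radius_le0 j r0) rR)).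
apply: le_measure; rewrite ?inE.
- exact: measurable_annulus.
- exact: measurable_ball_borel.
- by move=> y /andP[_]; rewrite in_ball.
Qed.

(** For p > 1 the N annuli have total energy at most 2^p C / N^(p-1), small for large N. For p = 1
    this does not decay in N, and one annulus of small radius r is used, of energy at most 2 C
    r^(q-1) with q > 1. *)
Lemma modulus_point : 1 <= p -> pointwise_dimension_set mu x p ->
  pointwise_dimension_set mu x <> `]0, 1]%classic ->
  forall s e, 0 < s -> 0 < e -> exists2 d, 0 < d & forall G : set (rect_curve X),
    (forall c, G c -> mdist x (c 0) <= d /\ s <= mdist x (c (arc_len c))) ->
    (modulus mu p G <= e%:E)%E.
Proof.
move=> p1 Qp QN s e s0 e0; have p0 : 0 < p by lra.
move: p1; rewrite le_eqVlt => /predU1P[p1|p1].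
- have [q q1 Qq] : exists2 q, 1 < q & pointwise_dimension_set mu x q.
    by apply: dimension_set_gt1 => //; rewrite p1.
  have [C [R0 [C0 R00 HC]]] := dimension_growth Qq.
  (* Solves 2 C b^(q-1) = e. *)
  pose b := (e / (2 * C)) `^ (q - 1)^-1.
  have eC : 0 < e / (2 * C) by rewrite divr_gt0// mulr_gt0.
  have b0 : 0 < b by exact: powR_gt0.
  pose r := Num.min s (Num.min R0 b).
  have r0 : 0 < r by rewrite !lt_min s0 R00 b0.
  have [rs rR rb] : [/\ r <= s, r <= R0 & r <= b].
    by rewrite /r !ge_min !lexx !orbT.
  exists (radius r 1); first exact: radius_gt0.
  move=> G HG; apply: (@modulus_le_density _ r 1 e) => //.
  + move=> j; apply: le_trans (annulus_measure_le 1 j r0 rR HC) _.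
    have rj := radius_gt0 j r0; have rjb := le_trans (radius_le0 j r0) rb.
    rewrite lee_fin -p1 powRr1; last by rewrite divr_ge0// mul1r ltW.
    have -> : radius r j `^ q = radius r j * radius r j `^ (q - 1).
      rewrite -{2}(powRr1 (ltW rj)) -powRD; first by congr (_ `^ _); ring.
      by rewrite (gt_eqF rj) implybT.
    rewrite (_ : _ * _ = 2 * C * radius r j `^ (q - 1)); last first.
      by field; rewrite gt_eqF.
    rewrite -ler_pdivlMl ?mulr_gt0// [leRHS]mulrC.
    have -> : e / (2 * C) = b `^ (q - 1).
      by rewrite /b -powRrM mulVf ?gt_eqF ?subr_gt0// powRr1// ltW.
    by apply: ge0_ler_powR => //; rewrite ?nnegrE; lra.
  + by rewrite mul1r.
  + by move=> c /HG[h1 h2]; split => //; exact: le_trans h2.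
- have [C [R0 [C0 R00 HC]]] := dimension_growth Qp.
  pose r := Num.min s R0.
  have r0 : 0 < r by rewrite !lt_min s0 R00.
  have [rs rR] : r <= s /\ r <= R0 by rewrite /r !ge_min !lexx !orbT.
  pose B := 2 `^ p * C / e.
  have B0 : 0 < B by rewrite divr_gt0// mulr_gt0// powR_gt0.
  (* Ensures N^(p-1) >= B, that is, 2^p C / N^(p-1) <= e. *)
  pose N := (Num.truncn (B `^ (p - 1)^-1)).+1.
  have N0 : 0 < N%:R :> R by rewrite ltr0n.
  have BN : B <= N%:R `^ (p - 1).
    have {1}-> : B = (B `^ (p - 1)^-1) `^ (p - 1).
      by rewrite -powRrM mulVf ?gt_eqF ?subr_gt0// powRr1// ltW.
    apply: ge0_ler_powR; rewrite ?nnegrE ?powR_ge0 ?(ltW N0)//; first lra.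
    by apply: ltW; exact: truncnS_gt.
  exists (radius r N); first exact: radius_gt0.
  have t0 : 0 < N%:R `^ (p - 1) by exact: powR_gt0.
  have E1 : (2 / N%:R) `^ p * (N%:R * N%:R `^ (p - 1)) = 2 `^ p.
    have -> : N%:R * N%:R `^ (p - 1) = N%:R `^ p.
      rewrite -{1}(powRr1 (ltW N0)) -powRD; first by congr (_ `^ _); ring.
      by rewrite (gt_eqF N0) implybT.
    by rewrite -powRM ?divr_ge0 ?(ltW N0)// divfK// gt_eqF.
  move=> G HG; apply: (@modulus_le_density _ r N ((2 / N%:R) `^ p * C)) => //.
  + move=> j; apply: le_trans (annulus_measure_le N j r0 rR HC) _.
    have rj := radius_gt0 j r0.
    rewrite lee_fin mulrCA mulrC ler_pM2r// -powRM ?(ltW rj)//; last first.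
      by rewrite divr_ge0// mulr_ge0// ltW.
    rewrite le_eqVlt; apply/orP; left; apply/eqP; congr (_ `^ _).
    by field; rewrite !gt_eqF.
  + rewrite (_ : _ * _ = 2 `^ p * C / N%:R `^ (p - 1)); last first.
      by rewrite -E1; field; rewrite gt_eqF.
    by rewrite ler_pdivrMr// [leRHS]mulrC -ler_pdivrMr.
  + by move=> c /HG[h1 h2]; split => //; exact: le_trans h2.
Qed.

(** As [x] is not in [Omega], a compact [K] stays at a distance [s] from it, while [E k] shrinks to
    [x]. The moduli are nonincreasing in [k], so their limit is their infimum. *)
Lemma singleton_mod_chain (Omega : set X) E : open Omega ->
  (forall (y : X) r, compact [set z : X | mdist y z <= r]) -> 1 <= p ->
  pointwise_dimension_set mu x p ->
  pointwise_dimension_set mu x <> `]0, 1]%classic ->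
  chain Omega E -> impression E = [set x] -> mod_chain Omega mu p E.
Proof.
move=> oO proper p1 Qp QN cE Ix; split => // K coK KO.
have nOx : ~ Omega x.
  have [_ _ _ IE] := cE; have [_] : boundary Omega x by apply: IE; rewrite Ix.
  by apply: contra_not => Ox; exact: open_nbhs_nbhs.
have cK : closed K by apply: compact_closed => //; exact: metric_hausdorff.
have [s s0 sK] : exists2 s, 0 < s & ball x s `<=` ~` K.
  by apply: ((openE_ball (~` K)).1 (closed_openC cK)) => /KO.
pose m k := modulus mu p (curves_between (E k) K Omega).
have m_le i j : (i <= j)%N -> (m j <= m i)%E.
  move=> ij; apply: le_ereal_inf => _ [rho [brho H] <-]; exists rho => //.
  split=> // c [cO c0 cL]; apply: H; split => //.
  exact: (chain_antitone cE ij c0).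
rewrite (_ : 0%E = ereal_inf (range m)); first exact: ereal_nonincreasing_cvgn.
apply/eqP; rewrite eq_le; apply/andP; split.
  apply: le_ereal_inf_tmp => _ [k _ <-]; apply: le_ereal_inf_tmp => _ [rho _ <-].
  by apply: integral_ge0 => y _; exact: poweR_ge0.
apply/lee_addgt0Pr => e e0; rewrite add0e.
have [d d0 Hd] := modulus_point p1 Qp QN s0 e0.
have [k Ek] := chain_to_point proper cE Ix d0.
apply: (@le_trans _ _ (m k)); first by apply: ereal_inf_lbound; exists k.
apply: Hd => c [_ /Ek + cL]; rewrite in_ball => /ltW h; split => //.
by rewrite leNgt; apply/negP; rewrite -in_ball => /sK; exact.
Qed.

End PointModulus.

(** * The equivalences for an accessible end *)

Theorem proposition7p9 (R : realType) (X : completeMetricType R)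
    (mu : {measure set (borel X) -> \bar R}) (p : R) (Omega : set X)
    (E : nat -> set X) (x : X) :
  (exists y z : X, y <> z) ->
  1 <= p ->
  balls_pos_finite mu ->
  doubling mu ->
  poincare mu p ->
  bounded_domain Omega ->
  Omega <> setT ->
  chain Omega E ->
  end_impression (end_of Omega E) x ->
  accessible_through Omega E x ->
  (prime_end Omega (end_of Omega E) <-> singleton_end Omega (end_of Omega E))
  /\
  (pointwise_dimension_set mu x p ->
   pointwise_dimension_set mu x <> `]0, 1]%classic ->
   (prime_end Omega (end_of Omega E) <->
      mod_prime_end Omega mu p (end_of Omega E)) /\
   (singleton_end Omega (end_of Omega E) <->
      mod_prime_end Omega mu p (end_of Omega E))).
Proof.
move=> _ p1 mub mud mup [_ _ _ oO] _ cE + [xO [c [cc c1 cO cEk]]].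
rewrite end_impressionE// => xE.
have proper (y : X) r : compact [set z : X | mdist y z <= r].
  exact: (cball_compact mub mud).
have [F [cF IF F0 tF]] := access_chain cc c1 cO xO oO
  (poincare_locally_connected p1 mub mud mup).
have FE : end_divides (end_of Omega F) (end_of Omega E).
  apply/(end_dividesE cF cE); apply: (tail_divides cE _ _ F0 tF cEk) => k.
    exact: chain_connected cF.
  exact: chain_sub.
(* [F] has impression {[x]} and divides [E], so either form of primality reduces to showing that the
   two ends coincide. *)
have EF_single : end_of Omega F = end_of Omega E -> singleton_end Omega (end_of Omega E).
  move=> EF; apply/(singleton_endE cE); exists x.
  by rewrite -(end_impressionE cE) -EF (end_impressionE cF).
have single_x : singleton_end Omega (end_of Omega E) -> impression E = [set x].
  by move=> /(singleton_endE cE)[y Iy]; move: xE; rewrite Iy => ->.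
have prime_single : prime_end Omega (end_of Omega E) <->
    singleton_end Omega (end_of Omega E).
  split=> [[_ H]|/single_x]; last exact: singleton_prime.
  by apply: EF_single; apply: H => //; exists F.
split=> // Qp QN; rewrite prime_single.
suff H : singleton_end Omega (end_of Omega E) <->
  mod_prime_end Omega mu p (end_of Omega E) by split.
have mod_of G : chain Omega G -> impression G = [set x] ->
    mod_end Omega mu p (end_of Omega G).
  move=> cG IG; split; first by exists G.
  by exists G; [exact: end_of_self|exact: (singleton_mod_chain mub oO proper p1 Qp QN)].
split=> [sE|[_ H]].
  split; first by apply: mod_of => //; exact: single_x.
  (* Primality among all ends applies in particular to the Mod_p-ends. *)
  have [_ H] := prime_single.2 sE.
  by move=> f [fe _]; exact: H.
(* The end of [F] is itself a Mod_p-end, being a singleton end at [x]. *)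
by apply: EF_single; apply: H => //; exact: mod_of.
Qed.
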